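(* Let $k$ be an algebraically closed field of characteristic zero, let $n\ge 2$, and let $C$ be a smooth projective curve over $k$ of genus $g\ge 2$ admitting a cyclic cover $C\to\mathbb P^1$ of degree $n$ with an affine model $y^n=h(x)$ (the cover being $x$) in which $h\in k[x]$ is separable. Then $n\le 2g+2$, and this bound is attained by the curve $y^{2g+2}=x^2-1$. If $C$ is not hyperelliptic, then $n\le g+2$, and this bound is attained by the curves $y^n=x^3-x$ with $3\mid n$, $n\ge 6$.
   Context: A cyclic cover of degree $n$ is a morphism $C\to C/\langle\tau\rangle\cong\mathbb P^1$, where $\tau\in\operatorname{Aut}(C)$ has order $n$ and $C/\langle\tau\rangle$ has genus zero. An affine equation denotes the smooth projective curve with that function field. ''Attained'' means: the curve $y^{2g+2}=x^2-1$ has genus $g$; and for $3\mid n$, $n\ge6$, the curve $y^n=x^3-x$ is non-hyperelliptic of genus $g'$ with $n=g'+2$. *)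

(* Defs.v *)
From HB Require Import structures.
From mathcomp Require Import all_boot all_order all_algebra all_field.
From mathcomp Require Import boolp.
From mathcomp Require Export freeg.

Set Implicit Arguments.
Unset Strict Implicit.
Unset Printing Implicit Defensive.

Import GRing.Theory Num.Theory.
Local Open Scope ring_scope.

(* [sub_basis E V b]: b is a basis of V over E, where E is a subfield of F and
   V an E-subspace of F, both given by their membership predicates. *)
Definition sub_basis (F : fieldType) (E V : F -> Prop) (d : nat)
    (b : 'I_d -> F) : Prop :=
  (forall z, V z <-> exists2 c : 'I_d -> F,
                       (forall i, E (c i)) & z = \sum_i c i * b i) /\
  (forall c : 'I_d -> F, (forall i, E (c i)) ->
     \sum_i c i * b i = 0 -> forall i, c i = 0).

Definition sub_dim (F : fieldType) (E V : F -> Prop) (d : nat) : Prop :=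
  exists b : 'I_d -> F, sub_basis E V b.

Definition constants (k F : fieldType) (iota : {rmorphism k -> F}) (z : F) :
    Prop :=
  exists a, z = iota a.

(* The subfield k(x) of F. *)
Definition ratfield (k F : fieldType) (iota : {rmorphism k -> F}) (x z : F) :
    Prop :=
  exists p q : {poly k}, (map_poly iota q).[x] != 0 /\
    z = (map_poly iota p).[x] / (map_poly iota q).[x].

(* [F : k(x)] = d *)
Definition ext_degree (k F : fieldType) (iota : {rmorphism k -> F}) (x : F)
    (d : nat) : Prop :=
  sub_dim (ratfield iota x) (fun=> True) d.

(* A smooth projective (integral) curve over k is given by its function field:
   a finitely generated extension of k of transcendence degree one.  The curve
   is recovered as the set of discrete valuations of this field that are
   trivial on k (the type [point] below). *)
Record curve (k : closedFieldType) := Curve {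
  funfield :> fieldType;
  cst : {rmorphism k -> funfield};
  curve_axiom : exists x : funfield,
    ~ algebraicOver cst x /\ exists d, ext_degree cst x d
}.
Arguments cst {k} c.

(* A closed point of C, as a normalized discrete valuation.  The value at 0 is
   irrelevant; it is set to 0 so that distinct points are distinct
   functions. *)
Record point (k : closedFieldType) (C : curve k) := Point {
  ord :> C -> int;
  ord0 : ord 0 = 0;
  ordM : forall a b, a != 0 -> b != 0 -> ord (a * b) = ord a + ord b;
  ordD : forall a b, a != 0 -> b != 0 -> a + b != 0 ->
    Num.min (ord a) (ord b) <= ord (a + b);
  ord_cst : forall c, c != 0 -> ord (cst C c) = 0;
  ord_uniformizer : exists2 t, t != 0 & ord t = 1
}.

HB.instance Definition _ (k : closedFieldType) (C : curve k) :=
  gen_eqMixin (point C).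
HB.instance Definition _ (k : closedFieldType) (C : curve k) :=
  gen_choiceMixin (point C).

(* Divisors are elements of {freeg (point C) / int}; as k is algebraically
   closed, every point has degree one and [deg] is the usual degree. *)
Definition riemann_roch_space (k : closedFieldType) (C : curve k)
    (D : {freeg (point C) / int}) (f : C) : Prop :=
  f = 0 \/ forall P : point C, - coeff P D <= P f.

(* g = max { deg D - l(D) + 1 | D a divisor }, with l(D) = dim_k L(D) *)
Definition has_genus (k : closedFieldType) (C : curve k) (g : nat) : Prop :=
  (forall (D : {freeg (point C) / int}) (l : nat),
     sub_dim (constants (cst C)) (riemann_roch_space D) l ->
     deg D - l%:Z + 1 <= g%:Z) /\
  (exists (D : {freeg (point C) / int}) (l : nat),
     sub_dim (constants (cst C)) (riemann_roch_space D) l /\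
     deg D - l%:Z + 1 = g%:Z).

Definition hyperelliptic (k : closedFieldType) (C : curve k) : Prop :=
  (exists2 g : nat, (2 <= g)%N & has_genus C g) /\
  (exists2 x : C, ~ algebraicOver (cst C) x & ext_degree (cst C) x 2).

(* Aut(C) is the (opposite of the) group of k-automorphisms of the function
   field. *)
Definition curve_automorphism (k : closedFieldType) (C : curve k)
    (tau : {rmorphism C -> C}) : Prop :=
  bijective tau /\ forall a, tau (cst C a) = cst C a.

Definition has_order (T : Type) (f : T -> T) (n : nat) : Prop :=
  [/\ (0 < n)%N, iter n f =1 id &
      forall m, (0 < m < n)%N -> ~ (iter m f =1 id)].

(* The rational function x : C -> P^1 is the quotient map of C by a cyclic
   group <tau> of order n: the function field of C/<tau>, i.e. the fixed field
   of tau, is k(x). *)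
Definition cyclic_cover (k : closedFieldType) (C : curve k) (n : nat) (x : C) :
    Prop :=
  ~ algebraicOver (cst C) x /\
  exists tau : {rmorphism C -> C},
    [/\ curve_automorphism tau, has_order tau n &
        forall z, tau z = z <-> ratfield (cst C) x z].

(* P(x, y), where the outer variable of P : k[X][Y] is Y. *)
Definition eval_xy (k : closedFieldType) (C : curve k) (x y : C)
    (P : {poly {poly k}}) : C :=
  (map_poly (map_poly (cst C)) P).[y%:P].[x].

(* y^n = h(x) is an affine model of C: the function field of C is the fraction
   field of k[X,Y]/(Y^n - h(X)), with x, y the images of X, Y.  In particular
   Y^n - h(X) is irreducible. *)
Definition affine_model (k : closedFieldType) (C : curve k) (n : nat)
    (h : {poly k}) (x y : C) : Prop :=
  (forall P : {poly {poly k}},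
     eval_xy x y P = 0 <-> exists Q, P = Q * ('X^n - h%:P)) /\
  (forall z : C, exists P Q : {poly {poly k}},
     eval_xy x y Q != 0 /\ z = eval_xy x y P / eval_xy x y Q).

Definition is_curve (k : closedFieldType) (n : nat) (h : {poly k})
    (C : curve k) : Prop :=
  exists x y : C, affine_model n h x y.

(* Main.v *)
(* Let m = deg h and c_j = ceil (j m / n).  Over a root a of h the map x is
   totally ramified at a single point P, and u = 1/(x - a) has its only pole
   there, of order n.  Averaging over the automorphisms y -> zeta y shows that
   the functions regular off P form the free k[u]-module on the u^(c_j) y^j,
   j < n.  Their orders at P are distinct modulo n, so
   l(N n P) = sum_j (N + 1 - c_j) for N >= m.  Up to linear equivalence every
   divisor is dominated by some N n P, and removing a point lowers l by at most
   one; hence the genus is 1 - n + sum_j c_j.  This is 0 for m = 1 and at least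
   n - 2 for m >= 3, while for m = 2 it is at least (n - 2)/2 and F = k(y)(x) is
   quadratic over k(y).  On y^n = x^3 - x a function t of degree 2 would give,
   with y of degree 3, genus at most (2 - 1)(3 - 1) = 2 (Castelnuovo).

   Points are produced by Zorn's lemma: a maximal subring containing k[u] but
   not 1/u is a discrete valuation ring.  That the zeros of u have total
   multiplicity at most [F : k(u)] follows from weak approximation. *)

From HB Require Import structures.
Require Import Defs.
From mathcomp Require Import all_boot all_order all_algebra all_field.
From mathcomp Require Import boolp cyclic.
From mathcomp Require classical_sets.
From mathcomp Require Import zify ring.

Set Implicit Arguments.
Unset Strict Implicit.
Unset Printing Implicit Defensive.

Import Order.TTheory GRing.Theory Num.Theory.
Local Open Scope ring_scope.

(** * Linear algebra over a subfield *)

(** The genus is a maximum over all divisors, so a bound valid for every D is needed besides one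
    divisor that attains it. Both are read off at the single point P. Since n ord(y) = ord(h(x)) at
    every point, orders are compared after multiplication by n, and neither the number nor the
    ramification of the points over infinity has to be found. The exponent c_j is the least c for
    which u^c y^j has no pole over infinity. As j < n and n c_j < j m + n, this product never
    reaches the order of u - c at a zero of u - c; that is why the coefficients in k(u) of a
    function regular off P have no denominators. A point costs at most one dimension because every
    residue field is k, which rests on the finiteness of F over k(x) and on k being algebraically
    closed. Characteristic zero provides the n distinct roots of unity, the division by n in the
    averaging, and the separability of x^2 - 1 and x^3 - x. *)

Section SubfieldDimension.
Variables (F : fieldType) (E : F -> Prop).

Definition subfield_prop :=
  [/\ E 1, forall a b, E a -> E b -> E (a - b) &
      forall a b, E a -> E b -> E (a / b)].

(** Any finite index type is allowed, because the families used later are indexed by pairs and by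
    dependent pairs. *)
Definition free_over (I : finType) (c : I -> F) :=
  forall a : I -> F, (forall i, E (a i)) ->
    \sum_i a i * c i = 0 -> forall i, a i = 0.

Definition spans (I : finType) (b : I -> F) (z : F) :=
  exists2 a : I -> F, (forall i, E (a i)) & z = \sum_i a i * b i.

(** One-sided bounds stand in for the dimension, so that spaces can be compared before they are
    known to be finite-dimensional. *)
Definition dim_ge (V : F -> Prop) (r : nat) :=
  exists2 c : 'I_r -> F, (forall i, V (c i)) & free_over c.

Definition dim_le (V : F -> Prop) (r : nat) :=
  forall s (c : 'I_s -> F), (forall i, V (c i)) -> free_over c -> (s <= r)%N.

Lemma free_reindex (I J : finType) (f : I -> J) (c : J -> F) :
  bijective f -> free_over c -> free_over (c \o f).
Proof.
move=> [g fK gK] frc a Ea sa0 i.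
have := frc (a \o g) (fun j => Ea (g j)) _ (f i) => /=; rewrite fK; apply.
rewrite -[RHS]sa0 (reindex f) /=; last by apply: onW_bij; exists g.
by apply: eq_bigr => j _; rewrite /= fK.
Qed.

Lemma dim_ge_card (I : finType) (V : F -> Prop) (c : I -> F) :
  (forall i, V (c i)) -> free_over c -> dim_ge V #|I|.
Proof.
move=> Vc frc; exists (c \o enum_val) => [i|]; first exact: Vc.
apply: free_reindex frc; exact: enum_val_bij.
Qed.

Lemma dim_ge_sub (V W : F -> Prop) r :
  (forall z, V z -> W z) -> dim_ge V r -> dim_ge W r.
Proof. by move=> VW [c Vc frc]; exists c => // i; apply/VW/Vc. Qed.

Lemma sub_dim_ge V d : sub_dim E V d -> E 0 -> E 1 -> dim_ge V d.
Proof.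
case=> b [Vb frb] E0 E1; exists b => // i; apply/Vb.
exists (fun j => (j == i)%:R) => [j|]; first by case: (j == i).
rewrite (bigD1 i) //= eqxx mul1r big1 ?addr0 // => j /negPf ->.
by rewrite mul0r.
Qed.

Hypothesis subE : subfield_prop.

Let E1 : E 1. Proof. by case: subE. Qed.
Let EB a b : E a -> E b -> E (a - b). Proof. by case: subE => _ + _; apply. Qed.
Let EV a b : E a -> E b -> E (a / b). Proof. by case: subE => _ _; apply. Qed.
Lemma sub0 : E 0. Proof. by rewrite -(subrr 1); apply: EB. Qed.
Lemma subN a : E a -> E (- a).
Proof. by rewrite -sub0r; apply: EB; apply: sub0. Qed.
Lemma subD a b : E a -> E b -> E (a + b).
Proof. by move=> Ea Eb; rewrite -[b]opprK; apply/EB/subN. Qed.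
Lemma subM a b : E a -> E b -> E (a * b).
Proof. by move=> Ea Eb; rewrite -[b]invrK; apply: EV => //; rewrite -div1r;
  apply: EV. Qed.
Lemma sub_sum (I : finType) (f : I -> F) : (forall i, E (f i)) -> E (\sum_i f i).
Proof. by move=> Ef; apply: big_ind => //; [exact: sub0|exact: subD]. Qed.

(** The predicate [E] is turned into a genuine field type, over which polynomial gcds and matrix
    ranks are available. *)
Definition sub_pred : {pred F} := fun z => `[< E z >].

Fact sub_pred_divring : divring_closed sub_pred.
Proof.
split=> [|a b|a b]; rewrite !unfold_in; first exact/asboolP.
  by move=> /asboolP Ea /asboolP Eb; apply/asboolP/EB.
by move=> /asboolP Ea /asboolP Eb; apply/asboolP/EV.
Qed.
HB.instance Definition _ := GRing.isDivringClosed.Build F sub_pred sub_pred_divring.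
Record sub_type := SubType { sub_val :> F; _ : sub_val \in sub_pred }.
HB.instance Definition _ := [isSub for sub_val].
HB.instance Definition _ := [Choice of sub_type by <:].
HB.instance Definition _ := [SubChoice_isSubIntegralDomain of sub_type by <:].
HB.instance Definition _ := [SubIntegralDomain_isSubField of sub_type by <:].

Lemma sub_typeP (z : sub_type) : E (val z).
Proof. by apply/asboolP; exact: (valP z). Qed.

Let coefE (p : {poly F}) := forall i, E p`_i.

Let poly_lift (p : {poly F}) : coefE p ->
  exists p' : {poly sub_type}, p = map_poly (val : {rmorphism sub_type -> F}) p'.
Proof.
move=> pE; exists (\poly_(i < size p) (insubd 0 p`_i : sub_type)).
apply/polyP => i; rewrite coef_map coef_poly; case: ltnP => [_|le].
  by apply/esym/insubdK/asboolP/pE.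
by rewrite nth_default // rmorph0.
Qed.

(** [mu] may be reducible and share factors with [q]. As q(y) is nonzero, [gdcop] strips these
    factors and still vanishes at y; a Bezout relation then inverts q(y) by a polynomial in y, and
    reduction modulo [mu] bounds the degree. *)
Lemma span_powers (y : F) (mu p q : {poly F}) d :
  (forall i, E mu`_i) -> mu \is monic -> size mu = d.+1 -> root mu y ->
  (forall i, E p`_i) -> (forall i, E q`_i) -> q.[y] != 0 ->
  spans (fun j : 'I_d => y ^+ j) (p.[y] / q.[y]).
Proof.
pose vl : {rmorphism sub_type -> F} := val.
move=> /poly_lift[m ->] mm szm my /poly_lift[{}p ->] /poly_lift[{}q ->] qy.
rewrite -/vl in mm szm my qy *; rewrite map_monic in mm; rewrite size_map_poly in szm.
have qn : q != 0 by apply: contraNneq qy => ->; rewrite rmorph0 horner0.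
have : root (map_poly vl (gdcop q m)) y.
  by rewrite gdcop_map root_gdco ?map_poly_eq0 ?monic_neq0 // my /root (negPf qy).
have /Bezout_eq1_coprimepP[[v w] /= vw] := coprimep_gdco q (monic_neq0 mm).
move=> /eqP gy.
have wq : (map_poly vl w).[y] * (map_poly vl q).[y] = 1.
  have := congr1 (fun r => (map_poly vl r).[y]) vw.
  by rewrite rmorphD !rmorphM rmorph1 !hornerE gy mulr0 add0r.
have -> : (map_poly vl p).[y] / (map_poly vl q).[y] =
    (map_poly vl ((p * w) %% m)).[y].
  have -> : (map_poly vl ((p * w) %% m)).[y] = (map_poly vl (p * w)).[y].
    rewrite [in RHS](divp_eq (p * w) m) rmorphD rmorphM !hornerE.
    by move: my => /eqP ->; rewrite mulr0 add0r.
  by apply: (mulIf qy); rewrite divfK // rmorphM hornerM -mulrA wq mulr1.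
exists (fun j : 'I_d => vl ((p * w) %% m)`_j) => [j|]; first exact: sub_typeP.
rewrite (@horner_coef_wide _ d).
  by apply: eq_bigr => j _; rewrite coef_map.
by rewrite size_map_poly -ltnS -szm ltn_modp monic_neq0.
Qed.

Lemma dep_mx d r (M : 'I_r -> 'I_d -> F) : (forall i j, E (M i j)) -> (d < r)%N ->
  exists a : 'I_r -> F, [/\ forall i, E (a i), exists i, a i != 0 &
    forall j, \sum_i a i * M i j = 0].
Proof.
move=> EM ltdr.
pose A : 'M[sub_type]_(r, d) := \matrix_(i, j) insubd 0 (M i j).
have /rowV0Pn[v /sub_kermxP vA v0] : kermx A != 0.
  rewrite -mxrank_eq0 mxrank_ker -lt0n subn_gt0.
  exact: leq_ltn_trans (rank_leq_col _) ltdr.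
exists (fun i => val (v 0 i)); split=> [i||j]; first exact: sub_typeP.
  case/rV0Pn: v0 => i vi; exists i.
  by rewrite -(rmorph0 (val : {rmorphism sub_type -> F})) (inj_eq val_inj).
have /matrixP/(_ 0 j) := vA; rewrite !mxE => /(congr1 (val : {rmorphism sub_type -> F})).
rewrite rmorph_sum rmorph0 => vA0; rewrite -[RHS]vA0; apply: eq_bigr => i _.
rewrite rmorphM mxE; congr (_ * _); apply/esym/insubdK/asboolP/EM.
Qed.

Lemma steinitz (I : finType) (b : I -> F) s (c : 'I_s -> F) :
  (forall i, spans b (c i)) -> free_over c -> (s <= #|I|)%N.
Proof.
move=> spc frc; rewrite leqNgt; apply/negP => lts.
have /choice[M MP] : forall i, exists m : I -> F,
    (forall j, E (m j)) /\ c i = \sum_j m j * b j.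
  by move=> i; have [m ? ?] := spc i; exists m.
have [|a [Ea [i0 ai0] aM]] := @dep_mx _ _ (fun i j => M i (enum_val j)) _ lts.
  by move=> i j; have [] := MP i.
move/eqP: ai0; apply; apply: frc => //.
under eq_bigr => i _ do rewrite (proj2 (MP i)) mulr_sumr.
rewrite exchange_big big1 //= => j _.
under eq_bigr do rewrite mulrA.
rewrite -mulr_suml; have := aM (enum_rank j).
by under eq_bigr do rewrite enum_rankK; move=> ->; rewrite mul0r.
Qed.

Lemma dim_le_span (I : finType) (b : I -> F) (V : F -> Prop) :
  (forall z, V z -> spans b z) -> dim_le V #|I|.
Proof. by move=> Vb s c Vc; apply: steinitz => i; apply/Vb/Vc. Qed.

Lemma sub_dim_le V d : sub_dim E V d -> dim_le V d.
Proof.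
case=> b [Vb frb]; rewrite -[d]card_ord; apply: (@dim_le_span _ b) => z /Vb.
by case=> c; exists c.
Qed.

Lemma sub_dim_basis (I : finType) (b : I -> F) (V : F -> Prop) :
  (forall z, spans b z <-> V z) -> free_over b -> sub_dim E V #|I|.
Proof.
move=> bV frb; exists (b \o enum_val); split; last first.
  by apply: free_reindex frb; exact: enum_val_bij.
move=> z; rewrite -bV; split=> -[a Ea ->].
  exists (a \o enum_val) => [i|]; first exact: Ea.
  by rewrite (reindex (enum_val : 'I_#|I| -> I)) //; apply: onW_bij; exact: enum_val_bij.
exists (a \o enum_rank) => [i|]; first exact: Ea.
rewrite [RHS](reindex (enum_val : 'I_#|I| -> I)) /=.
  by apply: eq_bigr => i _; rewrite enum_valK.
by apply: onW_bij; exact: enum_val_bij.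
Qed.

Lemma dim_ge_scale (V W : F -> Prop) c r : c != 0 ->
  (forall z, V z -> W (z * c)) -> dim_ge V r -> dim_ge W r.
Proof.
move=> cn VW [b Vb frb]; exists (fun i => b i * c) => [i|a Ea sa0]; first exact/VW/Vb.
apply: frb => //; apply: (mulIf cn); rewrite mul0r -[RHS]sa0 mulr_suml.
by apply: eq_bigr => i _; rewrite mulrA.
Qed.

Lemma dim_ge_le V r s : dim_ge V r -> dim_le V s -> (r <= s)%N.
Proof. by case=> c Vc frc; apply. Qed.

End SubfieldDimension.

(** * Rational functions of one element *)

Section Evaluation.
Variables (k F : fieldType) (iota : {rmorphism k -> F}) (u : F).

Definition evp (p : {poly k}) : F := (map_poly iota p).[u].

Fact evp_zmod_morphism : zmod_morphism evp.
Proof. by move=> p q; rewrite /evp rmorphB hornerD hornerN. Qed.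
Fact evp_monoid_morphism : monoid_morphism evp.
Proof.
by split=> [|p q]; rewrite /evp ?rmorph1 ?hornerC // rmorphM hornerM.
Qed.
HB.instance Definition _ := GRing.isZmodMorphism.Build _ _ evp evp_zmod_morphism.
HB.instance Definition _ :=
  GRing.isMonoidMorphism.Build _ _ evp evp_monoid_morphism.

Lemma evpC c : evp c%:P = iota c.
Proof. by rewrite /evp map_polyC hornerC. Qed.

Lemma evpX : evp 'X = u.
Proof. by rewrite /evp map_polyX hornerX. Qed.

Lemma evpXsubC c : evp ('X - c%:P) = u - iota c.
Proof. by rewrite rmorphB /= evpC evpX. Qed.

Lemma evpE p : evp p = \sum_(i < size p) iota p`_i * u ^+ i.
Proof.
rewrite /evp horner_coef size_map_poly; apply: eq_bigr => i _.
by rewrite coef_map.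
Qed.

Lemma evpZ c p : evp (c *: p) = iota c * evp p.
Proof. by rewrite -mul_polyC rmorphM /= evpC. Qed.

Lemma ratfield_sub : subfield_prop (ratfield iota u).
Proof.
split; first by exists 1, 1; rewrite -/(evp 1) rmorph1 divr1; split=> //;
  exact: oner_neq0.
  move=> a b [p1 [q1 [n1 ->]]] [p2 [q2 [n2 ->]]].
  exists (p1 * q2 - p2 * q1), (q1 * q2).
  rewrite -!/(evp _) rmorphB !rmorphM /=; split; first exact: mulf_neq0.
  by rewrite -/(evp q1) -/(evp q2) in n1 n2 *; field; rewrite n1 n2.
move=> a b [p1 [q1 [n1 ->]]] [p2 [q2 [n2 ->]]]; rewrite -!/(evp _) in n1 n2 *.
have [p20|p2n] := eqVneq (evp p2) 0.
  exists 0, 1; rewrite -!/(evp _) rmorph0 rmorph1 p20 mul0r invr0 mulr0 mul0r.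
  by split=> //; exact: oner_neq0.
exists (p1 * q2), (q1 * p2); rewrite -!/(evp _) !rmorphM /=.
by split; [exact: mulf_neq0|field; rewrite n1 n2 p2n].
Qed.

Lemma ratfield_evp p : ratfield iota u (evp p).
Proof. by exists p, 1; rewrite -!/(evp _) rmorph1 divr1; split=> //;
  exact: oner_neq0. Qed.

Lemma ratfield_cst c : ratfield iota u (iota c).
Proof. by rewrite -evpC; apply: ratfield_evp. Qed.

Lemma ratfield_id : ratfield iota u u.
Proof. by rewrite -{2}evpX; apply: ratfield_evp. Qed.

Lemma constants_sub : subfield_prop (constants iota).
Proof.
split; first by exists 1; rewrite rmorph1.
  by move=> a b [c ->] [d ->]; exists (c - d); rewrite rmorphB.
by move=> a b [c ->] [d ->]; exists (c / d); rewrite fmorph_div.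
Qed.

Lemma ratfield_min (E : F -> Prop) z : subfield_prop E -> E u ->
  (forall c, E (iota c)) -> ratfield iota u z -> E z.
Proof.
move=> subE Eu Ec [p [q [_ ->]]]; case: (subE) => _ _; apply.
  all: rewrite -/(evp _) evpE; apply: sub_sum => // i; apply: (subM subE) => //.
  all: elim: (nat_of_ord i) => [|m IHm]; first by case: (subE).
  all: by rewrite exprS; apply: (subM subE).
Qed.

Lemma dep_evp (I : finType) (b : I -> F) r (c : 'I_r -> F) :
  (forall z, spans (ratfield iota u) b z) -> (#|I| < r)%N ->
  exists2 p : 'I_r -> {poly k}, exists i, p i != 0 &
    \sum_i evp (p i) * c i = 0.
Proof.
move=> bP ltr.
have [frc|] := pselect (free_over (ratfield iota u) c).
  by have := steinitz ratfield_sub (fun i => bP (c i)) frc; rewrite leqNgt ltr.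
move/existsNP => [a /not_implyP[Ea /not_implyP[sa0 /existsNP[i0 ai0]]]].
have /choice[p /choice[q pqP]] := Ea.
(* The relation is multiplied by the product of all denominators; [qq i] is that product without the
   i-th one. *)
pose qq i := \prod_(j | j != i) q j.
have qn j : evp (q j) != 0 by have [] := pqP j.
exists (fun i => p i * qq i).
  exists i0; apply: contra_notN ai0 => /eqP/(congr1 evp).
  rewrite rmorph0 rmorphM /= rmorph_prod => /eqP; rewrite mulf_eq0.
  have [_ ->] := pqP i0; rewrite -/(evp _) -/(evp _).
  case/orP => [/eqP->|]; first by rewrite mul0r.
  by move=> /prodf_eq0[j _]; rewrite (negPf (qn j)).
transitivity (evp (\prod_j q j) * \sum_i a i * c i); last by rewrite sa0 mulr0.
rewrite mulr_sumr; apply: eq_bigr => i _.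
rewrite mulrA; congr (_ * _); have [_ ->] := pqP i.
rewrite -!/(evp _) (bigD1 i) //= !rmorphM /= -/(qq i); field; exact: qn.
Qed.

End Evaluation.

Lemma evp_comp (k F : fieldType) (iota : {rmorphism k -> F}) (u : F)
    (p q : {poly k}) : evp iota u (p \Po q) = evp iota (evp iota u q) p.
Proof. by rewrite /evp map_comp_poly horner_comp. Qed.

Lemma transc_shift (k F : fieldType) (iota : {rmorphism k -> F}) (u : F) c :
  ~ algebraicOver iota u -> ~ algebraicOver iota (u - iota c).
Proof.
move=> utr [p pn pu]; apply: utr; exists (p \Po ('X - c%:P)).
  by rewrite -size_poly_eq0 size_comp_poly2 ?size_XsubC // size_poly_eq0.
by rewrite /root -/(evp _ _ _) evp_comp evpXsubC.
Qed.

Lemma ratfield_trans (k F : fieldType) (iota : {rmorphism k -> F}) (x u z : F) :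
  ratfield iota u x -> ratfield iota x z -> ratfield iota u z.
Proof.
move=> xu; apply: ratfield_min => //; first exact: ratfield_sub.
exact: ratfield_cst.
Qed.

(** This normalises a k[u]-linear relation: after division by a power of u, some coefficient is
    nonzero modulo u. *)
Lemma factor_common_X (k : fieldType) (I : finType) (p : I -> {poly k}) :
  (exists i, p i != 0) -> exists N (q : I -> {poly k}),
    (forall i, p i = q i * 'X^N) /\ exists i, (q i).[0] != 0.
Proof.
case=> i0; move: {2}(size (p i0)) (leqnn (size (p i0))) => s.
elim: s p => [|s IHs] p; first by rewrite leqn0 size_poly_eq0 => ->.
move=> szp pi0; have [|pX] := pselect (exists i, (p i).[0] != 0).
  by exists 0%N, p; split=> // i; rewrite expr0 mulr1.
have /choice[q qP] : forall i, exists q, p i = q * 'X.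
  move=> i; have : root (p i) 0 by apply: contrapT => ri; apply: pX; exists i; exact/negP.
  by case/factor_theorem=> q; rewrite subr0; exists q.
have qi0 : q i0 != 0 by apply: contraNneq pi0; rewrite qP => ->; rewrite mul0r.
have [|//|N [q' [q'P nz]]] := IHs q.
  by move: szp; rewrite qP size_mulX.
exists N.+1, q'; split=> // i; by rewrite qP q'P exprSr mulrA.
Qed.

(** * Valuations *)

(* [lia] compares atoms syntactically, whereas valuations of the same function
   may differ by the ring instances found inside; [move:] identifies them. *)
Ltac ord_lia :=
  repeat match goal with
  | H : context [@ord _ _ _ _] |- _ => revert H
  end;
  repeat match goal with
  | |- context [@ord ?k ?C ?P ?f] => move: (@ord k C P f) => ?
  end; lia.

Section Valuation.
Variables (k : closedFieldType) (C : curve k).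
Implicit Types (P Q : point C) (f g : C).
Notation iota := (cst C).

(* The inequality [m <= ord_P f], with [ord_P 0] infinite. *)
Definition ord_ge P (m : int) f := f = 0 \/ m <= P f.

Lemma ord_one P : P 1 = 0.
Proof. by rewrite -(rmorph1 iota) ord_cst ?oner_neq0. Qed.

Lemma ordV P f : P f^-1 = - P f.
Proof.
have [->|fn] := eqVneq f 0; first by rewrite invr0 Defs.ord0 oppr0.
by apply/eqP; rewrite -addr_eq0 -ordM ?invr_eq0 // mulVf // ord_one.
Qed.

Lemma ord_div P f g : f != 0 -> g != 0 -> P (f / g) = P f - P g.
Proof. by move=> fn gn; rewrite ordM ?invr_eq0 // ordV. Qed.

Lemma ordN P f : P (- f) = P f.
Proof.
have [->|fn] := eqVneq f 0; first by rewrite oppr0.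
rewrite -mulN1r ordM ?oppr_eq0 ?oner_neq0 //.
by rewrite -(rmorph1 iota) -rmorphN ord_cst ?oppr_eq0 ?oner_neq0 // add0r.
Qed.

Lemma ordXn P f n : f != 0 -> P (f ^+ n) = P f * n%:Z.
Proof.
move=> fn; elim: n => [|n IHn]; first by rewrite expr0 ord_one mulr0.
by rewrite exprS ordM ?expf_neq0 // IHn; lia.
Qed.

Lemma ord_geE P m f : f != 0 -> ord_ge P m f -> m <= P f.
Proof. by move=> /eqP fn []. Qed.

Lemma ord_ge_le P m f : m <= P f -> ord_ge P m f. Proof. by right. Qed.

Lemma ord_geW P m m' f : m' <= m -> ord_ge P m f -> ord_ge P m' f.
Proof. by move=> mm [->|mf]; [left|right; apply: le_trans mm mf]. Qed.

Lemma ord_geN P m f : ord_ge P m f -> ord_ge P m (- f).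
Proof. by case=> [->|mf]; [left; rewrite oppr0|right; rewrite ordN]. Qed.

Lemma ord_geD P m f g : ord_ge P m f -> ord_ge P m g -> ord_ge P m (f + g).
Proof.
move=> [->|mf]; first by rewrite add0r.
move=> [->|mg]; first by rewrite addr0; right.
have [->|fn] := eqVneq f 0; first by rewrite add0r; right.
have [->|gn] := eqVneq g 0; first by rewrite addr0; right.
have [->|fgn] := eqVneq (f + g) 0; first by left.
by right; apply: (le_trans _ (ordD P fn gn fgn)); rewrite le_min mf mg.
Qed.

Lemma ord_geB P m f g : ord_ge P m f -> ord_ge P m g -> ord_ge P m (f - g).
Proof. by move=> ? ?; apply/ord_geD/ord_geN. Qed.

Lemma ord_geM P m m' f g :
  ord_ge P m f -> ord_ge P m' g -> ord_ge P (m + m') (f * g).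
Proof.
move=> [->|mf]; first by rewrite mul0r; left.
move=> [->|mg]; first by rewrite mulr0; left.
have [->|fn] := eqVneq f 0; first by rewrite mul0r; left.
have [->|gn] := eqVneq g 0; first by rewrite mulr0; left.
by right; rewrite ordM // lerD.
Qed.

Lemma ord_ge_cst P c : ord_ge P 0 (iota c).
Proof.
by have [->|cn] := eqVneq c 0; [rewrite rmorph0; left|right; rewrite ord_cst].
Qed.

Lemma ord_geZ P m c f : ord_ge P m f -> ord_ge P m (iota c * f).
Proof. by move=> fP; rewrite -[m]add0r; apply: ord_geM => //; apply: ord_ge_cst. Qed.

Lemma ord_geX P f n : ord_ge P 0 f -> ord_ge P 0 (f ^+ n).
Proof.
move=> fP; elim: n => [|n IHn]; first by right; rewrite expr0 ord_one.
by rewrite exprS -[0](addr0 0); apply: ord_geM.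
Qed.

Lemma ord_ge_sum P m (I : finType) (A : pred I) (f : I -> C) :
  (forall i, A i -> ord_ge P m (f i)) -> ord_ge P m (\sum_(i | A i) f i).
Proof. by move=> fP; apply: big_ind => //; [left|apply: ord_geD]. Qed.

Lemma ord_ge_evp P f p : ord_ge P 0 f -> ord_ge P 0 (evp iota f p).
Proof.
by move=> fP; rewrite evpE; apply: ord_ge_sum => i _; apply/ord_geZ/ord_geX.
Qed.

Lemma ord_addl P f g : f != 0 -> ord_ge P (P f + 1) g ->
  f + g != 0 /\ P (f + g) = P f.
Proof.
move=> fn [->|gP]; first by rewrite addr0.
have [->|gn] := eqVneq g 0; first by rewrite addr0.
have fgn : f + g != 0.
  by apply: contraTneq gP => /eqP; rewrite addr_eq0 => /eqP->; rewrite ordN -ltNge; lia.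
split=> //; have := ordD P fn gn fgn.
(* The reverse inequality comes from f = (f + g) - g. *)
have [gN fgf] : - g != 0 /\ f + g + - g != 0 by rewrite oppr_eq0 addrK.
have := ordD P fgn gN fgf; rewrite addrK ordN !ge_min; ord_lia.
Qed.

Lemma ord_sum_dominant P (I : finType) (f : I -> C) i0 : f i0 != 0 ->
  (forall i, i != i0 -> ord_ge P (P (f i0) + 1) (f i)) ->
  \sum_i f i != 0 /\ P (\sum_i f i) = P (f i0).
Proof.
by move=> fi0 fP; rewrite (bigD1 i0) //=; apply: ord_addl => //; apply: ord_ge_sum.
Qed.

Lemma ord_sum_distinct P (I : finType) (f : I -> C) :
  (forall i j, f i != 0 -> f j != 0 -> P (f i) = P (f j) -> i = j) ->
  forall i, f i != 0 -> \sum_j f j != 0 /\ P (\sum_j f j) <= P (f i).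
Proof.
move=> injP i fi.
case: (@arg_minP _ _ I i (fun j => f j != 0) (fun j => P (f j)) fi) => j fj jmin.
have [|? ->] := @ord_sum_dominant P I f j fj; last by split=> //; exact: jmin.
move=> l lj; have [->|fl] := eqVneq (f l) 0; first by left.
right; have := jmin _ fl; rewrite le_eqVlt => /orP[/eqP e|]; last by lia.
by rewrite (injP _ _ fj fl e) eqxx in lj.
Qed.

Lemma free_ord_inj P (I : finType) (f : I -> C) : (forall i, f i != 0) ->
  (injective (fun i => P (f i))) -> free_over (constants iota) f.
Proof.
move=> fn injP a /choice[c ac] sa0 i; apply/eqP; apply: contra_eqT sa0 => ai.
have [//||] := @ord_sum_distinct P I (fun i => a i * f i) _ i; last 2 first.
- by rewrite mulf_neq0.
- by [].
have cn j : a j != 0 -> c j != 0.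
  by apply: contra_neq => c0; rewrite ac c0 rmorph0.
move=> j l; rewrite !mulf_eq0 !negb_or => /andP[/cn aj _] /andP[/cn al _].
by rewrite !ac !ordM ?fmorph_eq0 // !ord_cst // !add0r; apply: injP.
Qed.

Lemma ord_evp_at P u a p : ord_ge P 1 (u - iota a) -> p.[a] != 0 ->
  evp iota u p != 0 /\ P (evp iota u p) = 0.
Proof.
move=> uP p0; have /factor_theorem[q /eqP] : root (p - (p.[a])%:P) a.
  by rewrite /root hornerD hornerN hornerC subrr.
rewrite subr_eq addrC => /eqP ->.
rewrite rmorphD /= evpC -(ord_cst P p0); apply: ord_addl; first by rewrite fmorph_eq0.
rewrite ord_cst // rmorphM /= evpXsubC; apply: ord_geM => //.
rewrite -(subrK (iota a) u); apply/ord_ge_evp/ord_geD; last exact: ord_ge_cst.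
exact: ord_geW uP.
Qed.

Lemma ord_evp_unit P u p : ord_ge P 1 u -> p.[0] != 0 ->
  evp iota u p != 0 /\ P (evp iota u p) = 0.
Proof. by move=> uP; apply: ord_evp_at; rewrite rmorph0 subr0. Qed.

Lemma ord_evp P u p : u != 0 -> 0 < P u -> p != 0 ->
  evp iota u p != 0 /\ exists N : nat, P (evp iota u p) = N%:Z * P u.
Proof.
move=> un uP pn; have [N [q [qP [[] q0]]]] :=
  @factor_common_X _ unit (fun _ => p) (ex_intro _ tt pn).
have uP1 : ord_ge P 1 u by right; lia.
have [qn vq] := ord_evp_unit uP1 q0; rewrite (qP tt) rmorphM rmorphXn /= evpX.
rewrite mulf_neq0 ?expf_neq0 //; split=> //; exists N.
by rewrite ordM ?expf_neq0 // vq ordXn // add0r mulrC.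
Qed.

Lemma ord_evp_pole P u p : u != 0 -> P u < 0 -> p != 0 ->
  evp iota u p != 0 /\ P (evp iota u p) = (size p).-1%:Z * P u.
Proof.
move=> un uP pn; have sp : (0 < size p)%N by rewrite lt0n size_poly_eq0.
rewrite evpE; set m := (size p).-1; have ltm : (m < size p)%N by rewrite /m prednK.
have lcn : iota p`_m * u ^+ m != 0.
  by rewrite mulf_neq0 ?expf_neq0 // fmorph_eq0 -/(lead_coef p) lead_coef_eq0.
have vm : P (iota p`_m * u ^+ m) = m%:Z * P u.
  rewrite ordM ?expf_neq0 ?ord_cst ?fmorph_eq0 ?ordXn //.
  - by rewrite add0r mulrC.
  - by rewrite -/(lead_coef p) lead_coef_eq0.
  - by rewrite -/(lead_coef p) lead_coef_eq0.
have [|? ->] := @ord_sum_dominant P _ (fun i : 'I_(size p) => iota p`_i * u ^+ i)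
   (Ordinal ltm) lcn; last by rewrite vm.
move=> i im; rewrite /= vm; have [p0|pin] := eqVneq p`_i 0.
  by left; rewrite p0 rmorph0 mul0r.
right; rewrite ordM ?expf_neq0 ?ord_cst ?fmorph_eq0 ?ordXn // add0r.
have : (i < m)%N by rewrite ltn_neqAle im /= -ltnS /m prednK.
by move: uP; clear; move: (P u) (nat_of_ord i) => a j; nia.
Qed.

Lemma point_eq P Q : (forall f, P f = Q f) -> P = Q.
Proof.
case: P Q => [p p1 p2 p3 p4 p5] [q q1 q2 q3 q4 q5] /= /funext epq.
by subst q; congr Point; exact: Prop_irrelevance.
Qed.

(* A discrete valuation ring is a maximal proper subring of its field, so two
   valuations whose rings are nested coincide. *)
Lemma point_sep P Q : P != Q -> exists f, [/\ f != 0, 0 <= P f & Q f < 0].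
Proof.
move=> /eqP PQ; apply: contrapT => nosep; apply: PQ.
have le f : f != 0 -> 0 <= P f -> 0 <= Q f.
  by move=> fn Pf; rewrite leNgt; apply/negP => Qf; apply: nosep; exists f.
have eq0 f : f != 0 -> P f = 0 -> Q f = 0.
  move=> fn Pf; apply/eqP; rewrite eq_le le ?Pf // andbT -oppr_ge0 -ordV.
  by rewrite le ?invr_eq0 // ordV Pf oppr0.
have [t tn t1] := ord_uniformizer P; have [s sn s1] := ord_uniformizer Q.
(* f is t^(P f) times a unit of P, and units of P are units of Q. Applied to a uniformizer s of Q
   this forces Q t = 1. *)
have expz f : f != 0 -> Q f = P f * Q t.
  move=> fn; have [m [Pf|Pf]] : exists m : nat, P f = m%:Z \/ P f = - m%:Z.
  - by case: (P f) => m; [exists m; left|exists m.+1; right; rewrite NegzE].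
  - have /eq0 : P (f / t ^+ m) = 0.
      by rewrite ord_div ?expf_neq0 // ordXn // t1 Pf; lia.
    rewrite ord_div ?expf_neq0 // ordXn // mulf_neq0 ?invr_eq0 ?expf_neq0 //.
    by move=> /(_ isT); rewrite Pf; lia.
  - have /eq0 : P (f * t ^+ m) = 0 by rewrite ordM ?expf_neq0 // ordXn // t1 Pf; lia.
    rewrite ordM ?expf_neq0 // ordXn // mulf_neq0 ?expf_neq0 // => /(_ isT).
    by rewrite Pf; lia.
have Qt : 0 <= Q t by apply: le => //; rewrite t1.
have Qt1 : Q t = 1.
  move: s1 Qt; rewrite expz //; clear; move: (P s) (Q t) => a b ab b0.
  by have [a0|a0] : a <= 0 \/ 0 < a; [lia|nia|nia].
apply: point_eq => f; have [->|fn] := eqVneq f 0; first by rewrite !Defs.ord0.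
by rewrite expz // Qt1 mulr1.
Qed.

End Valuation.

(** The polynomial [p] takes the value 1 on [s], so its roots avoid [s]. The extra factor ['X] keeps
    its degree positive when [s] is empty. *)
Lemma closed_avoid (k : closedFieldType) (s : seq k) : exists c, c \notin s.
Proof.
pose p : {poly k} := \prod_(a <- s) ('X - a%:P) * 'X + 1.
have szp : size p = (size s).+2.
  have pn : \prod_(a <- s) ('X - a%:P) != 0 by exact/monic_neq0/monic_prod_XsubC.
  by rewrite size_polyDl size_mulX // size_prod_XsubC // size_poly1.
have /closed_rootP[c] : size p != 1%N by rewrite szp.
rewrite /root !hornerE => pc; exists c; apply: contraTN pc => cs.
have : root (\prod_(a <- s) ('X - a%:P)) c by rewrite root_prod_XsubC.
by rewrite /root => /eqP ->; rewrite mul0r add0r oner_eq0.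
Qed.

(** * Weak approximation and zeros of a function *)

Section Approximation.
Variables (k : closedFieldType) (C : curve k).
Implicit Types (P Q : point C) (f g : C) (s : seq (point C)).
Notation iota := (cst C).

Lemma ord_geNP P f m : ~ ord_ge P m f -> f != 0 /\ P f < m.
Proof.
move=> nP; split; first by apply/eqP => f0; apply: nP; left.
by rewrite ltNge; apply/negP => le; apply: nP; right.
Qed.

(* In the induction step [f] is sought as [g + c w]: for each point at which [g]
   or [w] has a pole, at most one constant [c] makes it regular. *)
Lemma simultaneous_pole P s : P \notin s ->
  exists f, [/\ f != 0, 0 < P f & forall Q, Q \in s -> Q f < 0].
Proof.
elim: s => [_|Q s IHs].
  by have [t tn t1] := ord_uniformizer P; exists t; rewrite t1.
rewrite inE negb_or => /andP[PQ /IHs[g [gn Pg sg]]].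
have [f1 [f1n Pf1 Qf1]] := point_sep PQ.
have [|f2 [f2n Qf2 Pf2]] := @point_sep _ _ Q P; first by rewrite eq_sym.
pose w := f1 / f2.
have wn : w != 0 by rewrite mulf_neq0 ?invr_eq0.
have Pw : 0 < P w by rewrite ord_div //; ord_lia.
have Qw : Q w < 0 by rewrite ord_div //; ord_lia.
pose bad R c := R \in Q :: s /\ ord_ge R 0 (g + iota c * w).
have bad1 R c d : bad R c -> bad R d -> c = d.
  move=> [Rs bc] [_ bd]; apply: contrapT => cd.
  have Rw : 0 <= R w.
    apply: ord_geE wn _; suff -> : w = iota (c - d)^-1 *
        ((g + iota c * w) - (g + iota d * w)) by exact/ord_geZ/ord_geB.
    rewrite opprD addrACA subrr add0r -mulrBl -rmorphB mulrA -rmorphM mulVf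
      ?rmorph1 ?mul1r //.
    by rewrite subr_eq0; apply/eqP.
  have Rg : 0 <= R g.
    apply: ord_geE gn _; rewrite -(addrK (iota c * w) g).
    by apply: ord_geB => //; apply/ord_geZ; right.
  move: Rs; rewrite inE => /orP[/eqP RQ|/sg]; last by ord_lia.
  by move: Rw; rewrite RQ; ord_lia.
have /choice[beta betaP] : forall R, exists b, forall c, bad R c -> c = b.
  move=> R; have [[b bb]|nb] := pselect (exists b, bad R b).
    by exists b => c bc; apply: bad1 bc bb.
  by exists 0 => c bc; case: nb; exists c.
have [c cs] := closed_avoid (map beta (Q :: s)).
have nbad R : R \in Q :: s -> ~ ord_ge R 0 (g + iota c * w).
  move=> Rs Rc; have /betaP cb : bad R c by [].
  by move: cs; rewrite cb map_f.
exists (g + iota c * w).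
have [zn _] := ord_geNP (nbad Q (mem_head _ _)); split=> //.
  have : ord_ge P 1 (g + iota c * w).
    by apply: ord_geD; [right|apply: ord_geZ; right]; ord_lia.
  by move/(ord_geE zn); ord_lia.
by move=> R /nbad /ord_geNP[].
Qed.

(** If g vanishes at P and has poles on s, then 1/(1 + g) is a unit at P and vanishes on s. *)
Lemma simultaneous_zero P s : P \notin s ->
  exists f, [/\ f != 0, P f = 0 & forall Q, Q \in s -> 0 < Q f].
Proof.
move=> /simultaneous_pole[g [gn Pg sg]].
have [||n1 v1] := @ord_addl _ _ P 1 g; first exact: oner_neq0.
  by right; rewrite ord_one; ord_lia.
exists (1 + g)^-1; rewrite invr_eq0 ordV v1 ord_one oppr0; split=> // Q Qs.
rewrite ordV addrC; have [//||_ ->] := @ord_addl _ _ Q g 1.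
  by right; rewrite ord_one; have := sg _ Qs; ord_lia.
by rewrite oppr_gt0 sg.
Qed.

(** The function f^M t^j works: t is a uniformizer at P, and f is a unit at P that vanishes on the
    rest of s. The exponent M outweighs both the order of u and a possible pole of t^j at every
    other point of s. *)
Lemma prescribed_orders u P s (j : nat) : P \in s -> uniq s ->
  exists z, [/\ z != 0, P z = j & forall Q, Q \in s -> Q != P -> Q u <= Q z].
Proof.
move=> Ps us; have [|f [fn Pf sf]] := @simultaneous_zero P (rem P s).
  by rewrite mem_rem_uniqF.
have [t tn t1] := ord_uniformizer P.
pose M := (\sum_(Q <- s) (`|Q u| + j * `|Q t|))%N.
exists (f ^+ M * t ^+ j); rewrite mulf_neq0 ?expf_neq0 //; split=> //.
  by rewrite ordM ?expf_neq0 // !ordXn // Pf t1; lia.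
move=> Q Qs QP; rewrite ordM ?expf_neq0 // !ordXn //.
have Qf : 0 < Q f by apply: sf; rewrite mem_rem_uniq // !inE QP.
have : (`|Q u| + j * `|Q t| <= M)%N by rewrite /M (big_rem Q) //= leq_addr.
move: Qf; move: (Q u) (Q t) (Q f) M => a b c M c0 le.
have : M%:Z <= c * M%:Z by nia.
have : - (j * `|b|)%N%:Z <= b * j%:Z by nia.
lia.
Qed.

Lemma dep_evp_fin u (I J : finType) (b : I -> C) (c : J -> C) :
  u != 0 -> (forall z, spans (ratfield iota u) b z) -> (#|I| < #|J|)%N ->
  exists2 p : J -> {poly k}, exists i, (p i).[0] != 0 &
    \sum_i evp iota u (p i) * c i = 0.
Proof.
move=> un bP /(dep_evp (c \o enum_val) bP)[p [i0 pi0] sp0].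
have [|N [q [qP [i qi]]]] := @factor_common_X _ _ (p \o enum_rank).
  by exists (enum_val i0); rewrite /= enum_valK.
exists q; first by exists i.
apply: (mulIf (expf_neq0 N un)); rewrite mul0r -[RHS]sp0 mulr_suml.
rewrite (reindex (enum_val : 'I_#|J| -> J)) /=; last by apply: onW_bij;
  exact: enum_val_bij.
apply: eq_bigr => j _; have := qP (enum_val j); rewrite /= enum_valK => ->.
by rewrite rmorphM rmorphXn /= evpX mulrAC.
Qed.

(* The degree of the zero divisor of [u] is at most [[F : k(u)]]. *)
Lemma zeros_le_degree u (I : finType) (b : I -> C) s :
  u != 0 -> (forall z, spans (ratfield iota u) b z) -> uniq s ->
  (forall Q, Q \in s -> 0 < Q u) -> (\sum_(Q <- s) `|Q u| <= #|I|)%N.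
Proof.
move=> un bP us su; rewrite leqNgt; apply/negP => ltI.
pose P0 (i : 'I_(size s)) := tnth (in_tuple s) i.
have P0s i : P0 i \in s by exact: mem_tnth.
have P0inj : injective P0 by apply/tuple_uniqP.
(* One function for each point P_i and each j below the order of u there: order j at P_i, at least
   that of u at the other points. There are as many as zeros counted with multiplicity, and they
   turn out to be independent modulo u. *)
pose J := {i : 'I_(size s) & 'I_(`|P0 i u|)}.
pose Tg i j : J := @Tagged _ i (fun i => 'I_(`|P0 i u|)) j.
have cardJ : #|{: J}| = (\sum_(Q <- s) `|Q u|)%N.
  rewrite card_tagged sumnE big_map big_enum /= (big_tnth _ _ s).
  by apply: eq_bigr => i _; rewrite card_ord.
have /choice[z zP] : forall x : J, exists z, [/\ z != 0,
    P0 (tag x) z = tagged x & forall Q, Q \in s -> Q != P0 (tag x) -> Q u <= Q z].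
  by move=> x; apply: prescribed_orders.
have [|p [x1 px1] sp0] := @dep_evp_fin u I _ b z un bP; first by rewrite cardJ.
(* Among the coefficients that are nonzero modulo u, one with least exponent j0 is chosen. At P_i0
   its term has order exactly j0. Terms attached to other points, or with coefficient divisible by
   u, have at least the order of u, which exceeds j0; the remaining ones have larger exponent. *)
case: (@arg_minnP _ x1 (fun x => (p x).[0] != 0) (fun x : J =>
  tagged x : nat) px1) => -[i0 j0]; rewrite -/(Tg i0 j0) => px0 xmin.
have ui : ord_ge (P0 i0) 1 u by right; have := su _ (P0s i0); ord_lia.
have [pn pv] := ord_evp_unit ui px0.
have [zn zv zo] := zP (Tg i0 j0).
have [||+ _] := @ord_sum_dominant _ _ (P0 i0) _
  (fun x : J => evp iota u (p x) * z x) (Tg i0 j0); first exact: mulf_neq0.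
  2: by rewrite sp0 eqxx.
rewrite ordM // pv zv add0r /= => -[i j]; rewrite -/(Tg i j) => ne.
have j0lt : j0%:Z + 1 <= P0 i0 u.
  by have := ltn_ord j0; have := su _ (P0s i0); ord_lia.
have ev0 : ord_ge (P0 i0) 0 (evp iota u (p (Tg i j))).
  by apply/ord_ge_evp/ord_geW/ui.
have [zjn zjv zjo] := zP (Tg i j).
have [ei|nei] := eqVneq i i0; last first.
  rewrite -[_ + 1]add0r; apply: ord_geM => //; right; apply: (le_trans j0lt).
  by apply: zjo => //=; rewrite (inj_eq P0inj) eq_sym.
subst i0; have jj : j != j0 by apply: contraNneq ne => ->.
have [pj0|pj0] := eqVneq (p (Tg i j)).[0] 0.
  have /factor_theorem[q ->] : root (p (Tg i j)) 0 by apply/eqP.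
  rewrite subr0 rmorphM /= evpX -mulrA -[_ + 1]add0r; apply: ord_geM.
    by apply/ord_ge_evp/ord_geW/ui.
  right; rewrite ordM //.
  by apply: (le_trans j0lt); rewrite /= in zjv; rewrite zjv; lia.
rewrite -[_ + 1]add0r; apply: ord_geM => //; right.
rewrite /= in zjv; rewrite zjv; have := xmin _ pj0; rewrite /=.
by move: jj; rewrite -val_eqE /=; lia.
Qed.

(** Each zero adds at least 1 to the sum bounded by [zeros_le_degree], so a largest set of zeros
    exists. It contains all of them, and the list repeats each by its multiplicity. *)
Lemma zero_divisor u (I : finType) (b : I -> C) :
  u != 0 -> (forall z, spans (ratfield iota u) b z) ->
  exists2 s : seq (point C), (size s <= #|I|)%N &
    forall Q, (count_mem Q s)%:Z = Num.max 0 (Q u).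
Proof.
move=> un bP; pose A m := `[< exists s, [/\ uniq s,
  forall Q, Q \in s -> 0 < Q u & size s = m] >].
have [||m /asboolP[s [us su sm]] mmax] := @ex_maxnP A #|I|.
- by exists 0%N; apply/asboolP; exists [::].
- move=> m /asboolP[s [us su <-]]; apply: leq_trans (zeros_le_degree un bP us su).
  rewrite -sum1_size big_seq [leqRHS]big_seq; apply: leq_sum => Q /su; ord_lia.
have sall Q : 0 < Q u -> Q \in s.
  move=> Qu; apply/negPn/negP => Qs; suff : (m.+1 <= m)%N by rewrite ltnn.
  apply: mmax; apply/asboolP; exists (Q :: s); rewrite /= Qs us sm; split=> // R.
  by rewrite inE => /orP[/eqP ->|/su].
exists (flatten [seq nseq `|(Q : point C) u| Q | Q <- s]).
  rewrite size_flatten /shape -map_comp sumnE big_map.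
  under eq_bigr do rewrite /= size_nseq.
  exact: zeros_le_degree bP us su.
move=> Q; have -> : count_mem Q (flatten [seq nseq `|(R : point C) u| R | R <- s]) =
    ((Q \in s) * `|Q u|)%N.
  elim: s us {su sm sall} => //= R s IHs /andP[Rs /IHs {}IHs].
  rewrite count_cat count_nseq IHs /= [in LHS]eq_sym.
  by rewrite in_cons; have [->|_] := eqVneq Q R; rewrite ?(negPf Rs) /= ?mul1n ?addn0.
case: (boolP (Q \in s)) => [/su Qu|/negP nQ].
  by rewrite mul1n (max_idPr _); ord_lia.
rewrite mul0n (max_idPl _) // leNgt; apply/negP => /sall //.
Qed.

End Approximation.

(** * Existence of zeros *)

Section PlaceExistence.
Variables (k : closedFieldType) (C : curve k).
Notation iota := (cst C).
Variables (u : C) (I : finType) (b : I -> C).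
Hypothesis u_transc : ~ algebraicOver iota u.
Hypothesis b_spans : forall z, spans (ratfield iota u) b z.

Lemma transc_neq0 : u != 0.
Proof.
apply/eqP => u0; apply: u_transc; exists 'X; first by rewrite polyX_eq0.
by rewrite map_polyX u0 /root hornerX.
Qed.
Let un := transc_neq0.

Lemma transc_evp p : p != 0 -> evp iota u p != 0.
Proof.
by move=> pn; apply/eqP => up; apply: u_transc; exists p => //; apply/eqP.
Qed.

Record good_ring (A : C -> Prop) : Prop := GoodRing {
  goodC : forall c, A (iota c);
  good_u : A u;
  goodB : forall x y, A x -> A y -> A (x - y);
  goodM : forall x y, A x -> A y -> A (x * y);
  good_uV : ~ A u^-1 }.

Lemma good_evp : good_ring (fun z => exists p, z = evp iota u p).
Proof.
split=> [c||x y [p ->] [q ->]|x y [p ->] [q ->]|[p up]].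
- by exists c%:P; rewrite evpC.
- by exists 'X; rewrite evpX.
- by exists (p - q); rewrite rmorphB.
- by exists (p * q); rewrite rmorphM.
have /transc_evp/eqP : 'X * p - 1 != 0.
  apply/eqP => /(congr1 (fun q : {poly k} => q.[0])); rewrite !hornerE.
  by move/eqP; rewrite oppr_eq0 oner_eq0.
by apply; rewrite rmorphB rmorphM rmorph1 /= evpX -up divff // subrr.
Qed.

Lemma maximal_good_ring : exists2 A, good_ring A &
  forall B : C -> Prop, good_ring B -> (forall z, A z -> B z) ->
    forall z, B z -> A z.
Proof.
have [|A [PA Amax]] := @classical_sets.Zorn_bigcup C
  (fun X => (forall z, ~ X z) \/ good_ring X).
  move=> S PS totS.
  have [[X SX gX]|noX] := pselect (exists2 X, S X & good_ring X); last first.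
    left=> z [X SX Xz]; have [/(_ z Xz)//|gX] := PS _ SX; apply: noX; by exists X.
  have common x y : classical_sets.bigcup S id x -> classical_sets.bigcup S id y ->
      exists Y, [/\ S Y, good_ring Y, Y x & Y y].
    move=> [Y SY Yx] [Z SZ Zy].
    have gY : good_ring Y by have [/(_ x Yx)|] := PS _ SY.
    have gZ : good_ring Z by have [/(_ y Zy)|] := PS _ SZ.
    have [YZ|ZY] := totS _ _ SY SZ; first by exists Z; split=> //; exact: YZ.
    by exists Y; split=> //; exact: ZY.
  right; split=> [c||x y Ux Uy|x y Ux Uy|[Y SY Yu]].
  - by exists X => //; exact: goodC.
  - by exists X => //; exact: good_u.
  - by have [Y [SY gY Yx Yy]] := common _ _ Ux Uy; exists Y => //; exact: goodB.
  - by have [Y [SY gY Yx Yy]] := common _ _ Ux Uy; exists Y => //; exact: goodM.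
  by have [/(_ _ Yu)|/good_uV] := PS _ SY.
have gA : good_ring A.
  case: PA => // A0; case: (Amax (fun z => exists p, z = evp iota u p)).
    split=> [z /A0 //|H].
    by apply: (A0 u); apply: H; exists 'X; rewrite evpX.
  by right; exact: good_evp.
exists A => // B gB AB z Bz; apply: contrapT => nAz.
by apply: (Amax B); [split=> // /(_ z Bz)|right].
Qed.

(** * A maximal ring containing k[u] but not 1/u is a discrete valuation ring *)

Section Maximal.
Variable A : C -> Prop.
Hypothesis gA : good_ring A.
Hypothesis Amax : forall B : C -> Prop, good_ring B -> (forall z, A z -> B z) ->
  forall z, B z -> A z.

Let AC := goodC gA.
Let AB := goodB gA.
Let AM := goodM gA.
Let A0 : A 0. Proof. by rewrite -(rmorph0 iota); apply: AC. Qed.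
Let A1 : A 1. Proof. by rewrite -(rmorph1 iota); apply: AC. Qed.
Let AN x : A x -> A (- x). Proof. by move=> ?; rewrite -sub0r; apply: AB. Qed.
Let AD x y : A x -> A y -> A (x + y).
Proof. by move=> ? ?; rewrite -[y]opprK; apply/AB/AN. Qed.
Let Asum (J : finType) (Q : pred J) (f : J -> C) :
  (forall i, Q i -> A (f i)) -> A (\sum_(i | Q i) f i).
Proof. by move=> fA; apply: big_ind. Qed.
Let AX x n : A x -> A (x ^+ n).
Proof. by move=> Ax; elim: n => [|n IHn]; rewrite ?expr0 // exprS; apply: AM. Qed.

Let coefA (p : {poly C}) := forall i, A p`_i.

(** A[z] is strictly larger than A, so by maximality it contains 1/u. *)
Let adjoin_good z : ~ A z ->
  exists2 p : {poly C}, coefA p & 1 = u * p.[z].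
Proof.
move=> nAz; apply: contrapT => np; apply: nAz.
apply: (Amax (B := fun w => exists2 p : {poly C}, coefA p & w = p.[z])).
- split=> [c||x y [p pA ->] [q qA ->]|x y [p pA ->] [q qA ->]|[p pA up]].
  + by exists (iota c)%:P; rewrite ?hornerC // => i; rewrite coefC; case: ifP.
  + exists u%:P; rewrite ?hornerC // => i; rewrite coefC; case: ifP => // _.
    exact: good_u.
  + by exists (p - q); rewrite ?hornerD ?hornerN // => i; rewrite coefB; apply: AB.
  + exists (p * q); rewrite ?hornerM // => i; rewrite coefM.
    by apply: Asum => j _; apply: AM.
  + by apply: np; exists p => //; rewrite -up divff.
- by move=> w Aw; exists w%:P; rewrite ?hornerC // => i; rewrite coefC; case: ifP.
- by exists 'X; rewrite ?hornerX // => i; rewrite coefX; case: (_ == _).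
Qed.

(* The classical argument that a maximal ring is a valuation ring: of two
   relations 1 = u p(z) = u q(1/z), the one of larger degree can be shortened. *)
Let adjoin_both N z (p q : {poly C}) : z != 0 -> coefA p -> coefA q ->
  (size p + size q <= N)%N -> 1 = u * p.[z] -> 1 = u * q.[z^-1] -> False.
Proof.
elim: N z p q => [|N IHN] z p q zn pA qA szN pz qz.
  move: szN; rewrite leqn0 addn_eq0 size_poly_eq0 => /andP[/eqP p0 _].
  by move: pz; rewrite p0 horner0 mulr0 => /eqP; rewrite oner_eq0.
wlog le : z p q zn pA qA szN pz qz / (size q <= size p)%N.
  move=> wl; have [le|/ltnW le] := leqP (size q) (size p); first exact: (wl z p q).
  by apply: (wl z^-1 q p); rewrite ?invr_eq0 ?invrK // addnC.
have [sp1|sp1] := leqP (size p) 1.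
  apply: (good_uV gA); move: pz; rewrite (size1_polyC sp1) hornerC => pz.
  have -> : u^-1 = p`_0 by apply: (mulfI un); rewrite divff.
  exact: pA.
pose d := (size p).-1; have szp : size p = d.+1 by rewrite /d prednK // ltnW.
have d0 : (0 < d)%N by rewrite -ltnS -szp.
(* Multiplying 1 = u q(1/z) by z^d gives (1 - u q_0) z^d = u q'(z) with q' of degree less than d.
   Hence in (1 - u q_0) u p(z) = 1 - u q_0 the top term of p can be replaced by lower ones, and u
   q_0 moves to the other side. Nothing has to be inverted. *)
pose r := (q`_0)%:P + (1 - u * q`_0) *: (\poly_(i < d) p`_i) +
   (p`_d * u) *: \poly_(j < d) q`_(d - j).
have uA : A u by exact: good_u.
apply: (IHN z r q) => //.
- move=> i; rewrite !coefD !coefZ !coef_poly coefC.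
  apply: AD; [apply: AD; [by case: ifP|]|].
    by apply: AM; [apply: AB => //; apply: AM|case: ifP].
  by apply: AM; [apply: AM|case: ifP].
- rewrite -ltnS; apply: leq_trans szN; rewrite szp addSn ltnS leq_add2r.
  rewrite /r (leq_trans (size_polyD _ _)) // geq_max (leq_trans (size_polyD _ _)).
    by rewrite (leq_trans (size_scale_leq _ _)) // size_poly.
  rewrite geq_max (leq_trans (size_polyC_leq1 _)) //.
  by rewrite (leq_trans (size_scale_leq _ _)) // size_poly.
rewrite /r !hornerE.
have pE : p.[z] = (\poly_(i < d) p`_i).[z] + p`_d * z ^+ d.
  by rewrite horner_poly horner_coef szp big_ord_recr.
have qE : z ^+ d * q.[z^-1] = q`_0 * z ^+ d + (\poly_(j < d) q`_(d - j)).[z].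
  rewrite horner_poly (@horner_coef_wide _ d.+1); last by rewrite -szp.
  rewrite big_ord_recl mulrDr.
  rewrite expr0 mulr1 mulrC; congr (_ + _); rewrite mulr_sumr.
  rewrite (reindex_inj rev_ord_inj); apply: eq_bigr => i _.
  rewrite /= /bump /= add1n subnSK // mulrCA; congr (_ * _).
  by rewrite exprVn -expfB_cond ?(negPf zn) ?leq_subr // subKn // ltnW.
set p' := (\poly_(i < d) p`_i).[z] in pE *.
set q' := (\poly_(j < d) q`_(d - j)).[z] in qE *.
have q'E : q' = z ^+ d * q.[z^-1] - q`_0 * z ^+ d by rewrite qE addrC addKr.
have uq : u * q' = z ^+ d * (1 - u * q`_0).
  by rewrite q'E {1}qz; ring.
have pz' : u * p' = 1 - u * p`_d * z ^+ d by rewrite pz pE; ring.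
transitivity (u * q`_0 + (1 - u * q`_0) * (u * p') + u * p`_d * (u * q')); last by ring.
by rewrite pz' uq; ring.
Qed.

Lemma valuation_ring z : z != 0 -> ~ A z -> A z^-1.
Proof.
move=> zn /adjoin_good[p pA pz]; apply: contrapT => /adjoin_good[q qA qz].
exact: (adjoin_both zn pA qA (leqnn _) pz qz).
Qed.

(** The maximal ideal of A. The clause z = 0 is separate because 0^-1 = 0 lies in A. *)
Let M z := A z /\ (z = 0 \/ ~ A z^-1).

Let MA x : M x -> A x. Proof. by case. Qed.

Let Mu : M u. Proof. by split; [exact: good_u|right; exact: good_uV]. Qed.

Let M0 : M 0. Proof. by split=> //; left. Qed.

Let MN x : M x -> M (- x).
Proof.
move=> [Ax [->|nA]]; first by rewrite oppr0.
by split; [exact: AN|right; rewrite invrN => /AN; rewrite opprK].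
Qed.

Let MM x y : M x -> A y -> M (x * y).
Proof.
move=> [Ax [->|nA]] Ay; first by rewrite mul0r.
split; first exact: AM.
have [->|yn] := eqVneq y 0; first by left; rewrite mulr0.
by right; rewrite invfM => /AM/(_ Ay); rewrite divfK.
Qed.

Let MD x y : M x -> M y -> M (x + y).
Proof.
wlog xy : x y / x != 0 -> A (y / x).
  move=> wl Mx My; have [->|xn] := eqVneq x 0; first by rewrite add0r.
  have [Ayx|nA] := pselect (A (y / x)); first exact: wl.
  have [->|yn] := eqVneq y 0; first by rewrite addr0.
  rewrite addrC; apply: wl => // _; rewrite -invf_div; apply: valuation_ring => //.
  by rewrite mulf_neq0 ?invr_eq0.
move=> Mx My; have [->|xn] := eqVneq x 0; first by rewrite add0r.
have -> : x + y = x * (1 + y / x) by field.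
by apply: MM => //; apply: AD => //; apply: xy.
Qed.

Let Msum (J : finType) (Q : pred J) (f : J -> C) :
  (forall i, Q i -> M (f i)) -> M (\sum_(i | Q i) f i).
Proof. by move=> fA; apply: big_ind. Qed.

Let M1 : ~ M 1.
Proof. by move=> [_ [/eqP|]]; [rewrite oner_eq0|rewrite invr1]. Qed.

Let Aevp p : A (evp iota u p).
Proof. by rewrite evpE; apply: Asum => i _; apply: AM => //; apply/AX/(good_u gA). Qed.

Let evp_unit p : p.[0] != 0 -> ~ M (evp iota u p).
Proof.
move=> p0; have /factor_theorem[q] : root (p - (p.[0])%:P) 0.
  by rewrite /root hornerD hornerN hornerC subrr.
rewrite subr0 => /eqP; rewrite subr_eq addrC => /eqP ->.
rewrite rmorphD rmorphM /= evpC evpX => Mc; apply: M1.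
have : M (iota p.[0]).
  rewrite -(addrK (evp iota u q * u) (iota _)); apply: MD => //.
  by apply/MN; rewrite mulrC; apply: MM.
move=> /MM/(_ (AC p.[0]^-1)); rewrite -rmorphM divff // rmorph1; exact.
Qed.

Let evp_multX p : p.[0] = 0 -> exists q, evp iota u p = u * evp iota u q.
Proof.
move=> p0; have /factor_theorem[q ->] : root p 0 by apply/eqP.
by exists q; rewrite subr0 rmorphM /= evpX mulrC.
Qed.

Let chain_lt (z : nat -> C) r : (forall i, (i <= r)%N -> z i != 0) ->
  (forall i, (i < r)%N -> M (z i.+1 / z i)) ->
  forall i j, (i < j <= r)%N -> M (z j / z i).
Proof.
move=> zn zM i j /andP[ij jr]; elim: j ij jr => // j IHj.
rewrite ltnS leq_eqVlt => /orP[/eqP ->|ij] jr; first exact: zM.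
have -> : z j.+1 / z i = z j.+1 / z j * (z j / z i) by rewrite mulrA divfK // zn // ltnW.
by apply: MM; [apply: zM|apply/MA/IHj => //; exact: ltnW].
Qed.

(* Elements whose values lie strictly between those of 1 and u are independent
   over k(u). *)
Let chain_bound (z : nat -> C) r : (forall i, (i <= r)%N -> z i != 0) ->
  (forall i, (i < r)%N -> M (z i.+1 / z i)) -> z 0%N = 1 -> z r = u ->
  (r <= #|I|)%N.
Proof.
move=> zn /(chain_lt zn) zM z0 zr; rewrite leqNgt; apply/negP => ltr.
have [|p [i1 pi1] sp0] := @dep_evp_fin _ _ u _ 'I_r b (fun i => z i) un b_spans.
  by rewrite card_ord.
case: (@arg_minnP _ i1 (fun i => (p i).[0] != 0) (fun i => i : nat) pi1) => i0 pi0 imin.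
have zi0 : z i0 != 0 by rewrite zn // ltnW.
apply: (evp_unit pi0).
have -> : evp iota u (p i0) = - \sum_(i | i != i0) evp iota u (p i) * (z i / z i0).
  apply: (mulIf zi0); rewrite mulNr mulr_suml; apply/eqP; rewrite -addr_eq0.
  apply/eqP; rewrite -[RHS]sp0 [RHS](bigD1 i0) //=; congr (_ + _).
  by apply: eq_bigr => i _; rewrite -mulrA divfK.
apply/MN/Msum => i ii0.
have [i0i|ii|/val_inj e] := ltngtP i0 i; last by rewrite e eqxx in ii0.
  rewrite mulrC; apply: MM => //; apply: zM; rewrite i0i; exact: ltnW.
have [|q ->] := @evp_multX (p i).
  apply/eqP; apply: contraTT ii => /imin; by rewrite -leqNgt.
have -> : u * evp iota u q * (z i / z i0) = z r / z i0 * (evp iota u q * z i).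
  by rewrite zr; field.
apply: MM; first by apply: zM; rewrite ltn_ord leqnn.
apply: AM => //; case: (posnP i) => [->|ipos]; first by rewrite z0.
by rewrite -(divr1 (z i)) -z0; apply/MA/zM; rewrite ipos ltnW.
Qed.

(* A longest chain of strict divisibilities from 1 to [u] starts with a
   uniformizer. *)
Lemma uniformizer_exists : exists2 t, t != 0 /\ M t &
  forall w, w != 0 -> M w -> A (w / t).
Proof.
pose ch r := `[< exists z : nat -> C, [/\ forall i, (i <= r)%N -> z i != 0,
  forall i, (i < r)%N -> M (z i.+1 / z i), z 0%N = 1 & z r = u] >].
have ch1 : ch 1%N.
  apply/asboolP; exists (fun i => if i == 0%N then 1 else u); split=> //.
    by move=> [|i] _ //=; exact: oner_neq0.
  by move=> [|//] _ /=; rewrite divr1.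
have [||r /asboolP[z [zn zM z0 zr]] rmax] := @ex_maxnP ch #|I|.
- by exists 1%N.
- by move=> r /asboolP[z [zn zM z0 zr]]; apply: chain_bound zn zM z0 zr.
have r0 : (0 < r)%N by apply: rmax.
exists (z 1%N); first by split; [exact: zn|rewrite -(divr1 (z 1%N)) -z0; apply: zM].
move=> w wn Mw; have z1n := zn _ r0.
apply: contrapT => nA; suff : (r.+1 <= r)%N by rewrite ltnn.
apply: rmax; apply/asboolP.
(* If w/t is not in A, then t/w lies in M, and w can be inserted between 1 and t = z_1: the chain
   was not longest. *)
exists (fun i => if i is i'.+1 then if i' is 0 then w else z i' else 1); split=> //.
- by move=> [|[|i]] //= ir; rewrite ?oner_neq0 // zn.
- move=> [|[|i]] //= ir; rewrite ?divr1 //; last exact: zM.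
  split; first by rewrite -invf_div; apply: valuation_ring; rewrite ?mulf_neq0 ?invr_eq0.
  by right; rewrite invf_div.
- by move: r0 zr; case: (r).
Qed.

(** This makes the valuation of rank one. In an algebraic equation of z over k[u], the lowest term
    is u^N z^i0 up to a unit of A, and all others are divisible by z^(i0 + 1). *)
Lemma divides_power_u z : z != 0 -> A z -> exists N, A (u ^+ N / z).
Proof.
move=> zn Az.
have [|p [i1 pi1] sp0] := @dep_evp_fin _ _ u _ 'I_(#|I|.+1) b (fun i =>
  z ^+ i) un b_spans.
  by rewrite card_ord.
have {}pi1 : p i1 != 0 by apply: contraNneq pi1 => ->; rewrite horner0.
case: (@arg_minnP _ i1 (fun i => p i != 0) (fun i => i : nat) pi1) => i0 pi0 imin.
have [N [q [qP [[] q0]]]] := @factor_common_X _ unit (fun _ => p i0) (ex_intro _ tt pi0).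
exists N.
have Aq : A (evp iota u (q tt))^-1.
  by apply: contrapT => nA; apply: (evp_unit q0); split=> //; right.
have qn : evp iota u (q tt) != 0 by apply: transc_evp; apply: contraNneq q0 => ->;
  rewrite horner0.
have -> : u ^+ N / z = (evp iota u (q tt))^-1 *
    - \sum_(i | i != i0) evp iota u (p i) * (z ^+ i / z ^+ i0.+1).
  apply: (mulfI qn); rewrite [RHS]mulrA divff // mul1r.
  apply: (mulIf (expf_neq0 i0.+1 zn)); rewrite mulNr mulr_suml.
  have -> : evp iota u (q tt) * (u ^+ N / z) * z ^+ i0.+1 = evp iota u (p i0) * z ^+ i0.
    by rewrite (qP tt) rmorphM rmorphXn /= evpX exprS; field.
  apply/eqP; rewrite -addr_eq0; apply/eqP; rewrite -[RHS]sp0 [RHS](bigD1 i0) //=.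
  congr (_ + _); apply: eq_bigr => i _; rewrite -mulrA divfK //.
  exact: expf_neq0.
apply: AM => //; apply/AN/Asum => i ii0.
have [p0|pin] := eqVneq (p i) 0; first by rewrite p0 rmorph0 mul0r.
have lt : (i0 < i)%N by rewrite ltn_neqAle eq_sym ii0 imin.
apply: AM => //; rewrite -expfB_cond ?(negPf zn) //; exact: AX.
Qed.

Let unit z := A z /\ A z^-1.

Let unitM x y : unit x -> unit y -> unit (x * y).
Proof. by move=> [Ax Ax'] [Ay Ay']; split; [|rewrite invfM]; apply: AM. Qed.

Let unitV x : unit x -> unit x^-1.
Proof. by case=> Ax Ax'; split; rewrite ?invrK. Qed.

(** Every nonzero element is a unit of A times a unique integral power of the uniformizer t; the
    exponent is the valuation. *)
Lemma place_of_maximal_ring : exists P : point C, 0 < P u.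
Proof.
have [t [tn Mt] tmin] := uniformizer_exists.
have ntV : ~ A t^-1 by case: Mt => _ [/eqP|//]; rewrite (negPf tn).
have tX0 i : A (t ^+ i)^-1 -> i = 0%N.
  case: i => // i AtV; case: ntV; suff -> : t^-1 = t ^+ i * (t ^+ i.+1)^-1.
    by apply: AM => //; exact/AX/MA.
  by rewrite exprS; field; rewrite tn expf_neq0.
have max_unit z : z != 0 -> A z -> (exists B, forall i, A (z / t ^+ i) -> (i <= B)%N) ->
    exists i : nat, unit (z / t ^+ i).
  move=> zn Az [B zB].
  have [||i /asboolP Ai imax] := @ex_maxnP (fun i => `[< A (z / t ^+ i) >]) B.
  - by exists 0%N; apply/asboolP; rewrite expr0 divr1.
  - by move=> i /asboolP/zB.
  exists i; split=> //; apply: contrapT => nAi.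
  have zin : z / t ^+ i != 0 by rewrite mulf_neq0 ?invr_eq0 ?expf_neq0.
  have /(tmin _ zin) Ai1 : M (z / t ^+ i) by split=> //; right.
  suff : (i.+1 <= i)%N by rewrite ltnn.
  apply: imax; apply/asboolP; rewrite exprSr invfM [_^-1 * _]mulrC mulrA.
  suff -> : z / t / t ^+ i = z / t ^+ i / t by []; by rewrite mulrAC.
have [e [_ eV]] : exists e : nat, unit (u / t ^+ e).
  apply: max_unit => //; first exact: good_u.
  (* If t^(i + 1) divides u, then 1, t, ..., t^i, u is a chain of strict divisibilities of length i
     + 1, which [chain_bound] limits. *)
  exists #|I| => -[//|i] Ai.
  apply: (@chain_bound (fun j => if j == i.+1 then u else t ^+ j)) => [j _|j ji||].
  - by case: ifP => _ //; exact: expf_neq0.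
  - rewrite (ltn_eqF ji) eqSS; case: eqP => [->|_].
      suff -> : u / t ^+ i = t * (u / t ^+ i.+1) by exact: MM.
      by rewrite exprS; field; rewrite tn expf_neq0.
    by rewrite exprS mulfK // expf_neq0.
  - by rewrite expr0.
  - by rewrite eqxx.
have expandA z : z != 0 -> A z -> exists i : nat, unit (z / t ^+ i).
  move=> zn Az; apply: max_unit => //; have [N AN'] := divides_power_u zn Az.
  (* u is a unit times t^e and z divides u^N, so no power of t beyond e N divides z. *)
  exists (e * N)%N => i Ai; rewrite leqNgt; apply/negP => lti.
  have /tX0 : A (t ^+ (i - e * N))^-1; last by apply/eqP; rewrite subn_eq0 -ltnNge.
  suff -> : (t ^+ (i - e * N))^-1 = (u / t ^+ e)^-1 ^+ N * (u ^+ N / z * (z / t ^+ i)).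
    by apply: AM; [exact: AX|exact: AM].
  rewrite -[in RHS](subnK (ltnW lti)) exprD exprM; set ti := t ^+ (_ - _).
  rewrite !exprVn expr_div_n; field.
  by rewrite zn !expf_neq0.
have expand z : z != 0 -> exists m : int, unit (z / t ^ m).
  move=> zn; have [/(expandA _ zn)[i ui]|nA] := pselect (A z); first by exists i.
  have [||i /unitV] := expandA z^-1; rewrite ?invr_eq0 //; first exact: valuation_ring.
  by rewrite invfM !invrK => ui; exists (- i%:Z); rewrite -invr_expz invrK.
have uniq_exp m n z : unit (z / t ^ m) -> unit (z / t ^ n) -> z != 0 -> m = n.
  wlog le : m n / m <= n.
    by move=> wl um vm zn; have [le|/ltW le] := leP m n; [|apply/esym]; exact: wl.
  move=> [_ um] [vn _] zn; have := AM um vn.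
  rewrite invf_div mulrA divfK // => Amn.
  suff : A (t ^+ `|n - m|)^-1 by move/tX0; lia.
  suff -> : (t ^+ `|n - m|)^-1 = t ^ m / t ^ n by [].
  rewrite -[t ^+ _]/(t ^ (Posz _)) gez0_abs ?subr_ge0 // expfzDr // -invr_expz
    invfM invrK.
  by rewrite mulrC.
have /choice[v vP] : forall z, exists m : int, (z = 0 -> m = 0) /\ (z != 0 ->
  unit (z / t ^ m)).
  move=> z; have [->|zn] := eqVneq z 0; first by exists 0; split=> // /eqP.
  by have [m um] := expand z zn; exists m; split=> // z0; rewrite z0 eqxx in zn.
have vunit z : z != 0 -> unit (z / t ^ v z) by have [] := vP z.
have vE z m : z != 0 -> unit (z / t ^ m) -> v z = m.
  by move=> zn um; apply: uniq_exp (vunit z zn) um zn.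
have tXn m : t ^ m != 0 by rewrite expfz_neq0.
have vA z m : z != 0 -> m <= v z -> A (z / t ^ m).
  move=> zn le; have [Az _] := vunit z zn.
  suff -> : z / t ^ m = z / t ^ v z * t ^+ `|v z - m| by apply: AM => //; exact/AX/MA.
  rewrite -[t ^+ _]/(t ^ (Posz _)) gez0_abs ?subr_ge0 // expfzDr // -invr_expz.
  by rewrite mulrA divfK.
have Av z m : z != 0 -> A (z / t ^ m) -> m <= v z.
  move=> zn Az; rewrite leNgt; apply/negP => lt.
  have [_ uz] := vunit z zn; have := AM uz Az.
  rewrite invf_div mulrA divfK // => Amn.
  suff : A (t ^+ `|m - v z|)^-1 by move/tX0; lia.
  suff -> : (t ^+ `|m - v z|)^-1 = t ^ v z / t ^ m by [].
  rewrite -[t ^+ _]/(t ^ (Posz _)) gez0_abs ?subr_ge0 ?ltW // expfzDr // -invr_expz invfM.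
  by rewrite invrK mulrC.
have v0 : v 0 = 0 by have [->] := vP 0.
have vM x y : x != 0 -> y != 0 -> v (x * y) = v x + v y.
  move=> xn yn; apply: vE; first exact: mulf_neq0.
  suff -> : x * y / t ^ (v x + v y) = (x / t ^ v x) * (y / t ^ v y).
    by apply: unitM; exact: vunit.
  by rewrite expfzDr // invfM mulrACA.
have vD x y : x != 0 -> y != 0 -> x + y != 0 -> Num.min (v x) (v y) <= v (x + y).
  move=> xn yn xyn; apply: Av => //; rewrite mulrDl.
  by apply: AD; apply: vA => //; rewrite ge_min lexx ?orbT.
have vC c : c != 0 -> v (cst C c) = 0.
  move=> cn; apply: vE; first by rewrite fmorph_eq0.
  by rewrite expr0z divr1; split=> //; rewrite -fmorphV.
have vt : exists2 s, s != 0 & v s = 1.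
  by exists t => //; apply: vE => //; rewrite expr1z divff //; split; rewrite ?invr1.
exists (Point v0 vM vD vC vt) => /=.
suff : 1 <= v u by lia.
by apply: Av => //; rewrite expr1z; apply: tmin.
Qed.

End Maximal.

Lemma zero_exists : exists P : point C, 0 < P u.
Proof.
have [A gA Amax] := maximal_good_ring.
exact: place_of_maximal_ring gA Amax.
Qed.

End PlaceExistence.

Lemma spans_ratfield (k F : fieldType) (iota : {rmorphism k -> F}) (x u : F)
    (I : finType) (b : I -> F) z :
  ratfield iota u x -> spans (ratfield iota x) b z -> spans (ratfield iota u) b z.
Proof. by move=> xu [a ax ->]; exists a => // i; apply: ratfield_trans xu (ax i). Qed.

Lemma evp_prod (k : closedFieldType) (F : fieldType) (iota : {rmorphism k -> F}) (x : F)
    (r : seq k) c : evp iota x (c *: \prod_(a <- r) ('X - a%:P)) =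
  iota c * \prod_(a <- r) (x - iota a).
Proof.
rewrite evpZ rmorph_prod; congr (_ * _); apply: eq_bigr => a _.
exact: evpXsubC.
Qed.

(** * Residues and Riemann-Roch spaces *)

Section Residue.
Variables (k : closedFieldType) (C : curve k).
Notation iota := (cst C).
Implicit Types (P Q : point C) (f g : C) (s : seq (point C)).

Lemma ord_prod P (I : Type) (r : seq I) (f : I -> C) :
  (forall i, f i != 0) -> (forall i, P (f i) = 0) ->
  \prod_(i <- r) f i != 0 /\ P (\prod_(i <- r) f i) = 0.
Proof.
move=> fn f0; elim: r => [|i r [IHn IH0]].
  by rewrite big_nil ord_one oner_neq0.
by rewrite big_cons mulf_neq0 // ordM // f0 IH0.
Qed.

(** 1/x or some x - c vanishes at P. Otherwise every nonzero polynomial in x would be a unit at P,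
    and the powers of a uniformizer would be independent over k(x), against the finite degree. *)
Lemma local_parameter x (I : finType) (b : I -> C) P :
  ~ algebraicOver iota x -> (forall z, spans (ratfield iota x) b z) ->
  exists u, [/\ ratfield iota x u, ratfield iota u x, u != 0 & 0 < P u].
Proof.
move=> xtr bx; apply: contrapT => nou.
have xn : x != 0 by exact: transc_neq0 xtr.
have Px : 0 <= P x.
  rewrite leNgt; apply/negP => Px; apply: nou; exists x^-1.
  have [E1 _ EV] := ratfield_sub iota x; have [E1' _ EV'] := ratfield_sub iota x^-1.
  split; rewrite ?invr_eq0 ?ordV; [|rewrite -{2}(invrK x)|by []|ord_lia].
    by rewrite -div1r; apply: EV => //; apply: ratfield_id.
  by rewrite -[_^-1^-1]div1r; apply: EV' => //; apply: ratfield_id.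
have xcn c : x - iota c != 0.
  by rewrite -evpXsubC; apply: transc_evp xtr _ _; rewrite polyXsubC_eq0.
have Pxc c : P (x - iota c) = 0.
  have : ord_ge P 0 (x - iota c) by apply: ord_geB; [right|exact: ord_ge_cst].
  move/(ord_geE (xcn c)) => le; apply/eqP; rewrite eq_le le andbT leNgt.
  apply/negP => lt; apply: nou; exists (x - iota c).
  split; rewrite ?xcn //; first by rewrite -evpXsubC; exact: ratfield_evp.
  rewrite -{2}(subrK (iota c) x); apply: (subD (ratfield_sub _ _)).
    exact: ratfield_id.
  exact: ratfield_cst.
have P0 p : p != 0 -> P (evp iota x p) = 0.
  have [r ->] := closed_field_poly_normal p; rewrite scaler_eq0 negb_or => /andP[cn _].
  have [pn p0] := @ord_prod P _ r (fun a => x - iota a) xcn Pxc.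
  by rewrite evp_prod ordM ?fmorph_eq0 // ord_cst // p0.
have [t tn t1] := ord_uniformizer P.
have [|p [i pi] sp0] := @dep_evp_fin _ _ x _ 'I_(#|I|.+1) b (fun i => t ^+ i) xn bx.
  by rewrite card_ord.
have pin : p i != 0 by apply: contraNneq pi => ->; rewrite horner0.
have [||+ _] := @ord_sum_distinct _ _ P _ (fun i => evp iota x (p i) * t ^+ i) _ i.
- move=> j l; rewrite !mulf_eq0 !negb_or => /andP[pj tj] /andP[pl tl].
  have pjn : p j != 0 by apply: contraNneq pj => ->; rewrite rmorph0.
  have pln : p l != 0 by apply: contraNneq pl => ->; rewrite rmorph0.
  by rewrite !ordM // !ordXn // !P0 // t1 !add0r !mul1r => -[] /val_inj.
- by rewrite mulf_neq0 ?expf_neq0 //; apply: transc_evp xtr _ _.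
- by rewrite sp0 eqxx.
Qed.

(* Reducing an algebraic equation of [f] over k[u] modulo [u], where [u] vanishes
   at [P], leaves a polynomial in [f] that vanishes at [P]; one of its linear
   factors does. *)
Lemma residue_exists x (I : finType) (b : I -> C) P f :
  ~ algebraicOver iota x -> (forall z, spans (ratfield iota x) b z) ->
  ord_ge P 0 f -> exists c, ord_ge P 1 (f - iota c).
Proof.
move=> xtr bx Pf; have [u [_ ux un Pu]] := local_parameter P xtr bx.
have uP1 : ord_ge P 1 u by right; ord_lia.
have bu z : spans (ratfield iota u) b z by exact: spans_ratfield ux (bx z).
have [|p [i pi] sp0] := @dep_evp_fin _ _ u _ 'I_(#|I|.+1) b (fun i => f ^+ i) un bu.
  by rewrite card_ord.
pose q : {poly k} := \poly_(j < #|I|.+1) (p (inord j)).[0].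
have qn : q != 0.
  apply/eqP => /(congr1 (fun q : {poly k} => q`_i)) /=.
  by rewrite coef_poly ltn_ord inord_val coef0; apply/eqP.
have : ord_ge P 1 (evp iota f q).
  have -> : evp iota f q = \sum_(j < #|I|.+1) evp iota f ((p j).[0]%:P * 'X^j).
    rewrite -rmorph_sum /q poly_def; congr (evp _ _ _); apply: eq_bigr => j _.
    by rewrite inord_val mul_polyC.
  rewrite -[X in ord_ge _ _ X]subr0 -[X in _ - X]sp0 -sumrB; apply: ord_ge_sum => j _.
  rewrite rmorphM rmorphXn /= evpX evpC -mulrBl -[1]addr0.
  apply: ord_geM; last exact: ord_geX.
  rewrite -opprB -(evpC iota u) -rmorphB /=; apply: ord_geN.
  have /factor_theorem[r ->] : root (p j - (p j).[0]%:P) 0.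
    by rewrite /root hornerD hornerN hornerC subrr.
  rewrite subr0 rmorphM /= evpX -[1]add0r; apply: ord_geM => //.
  exact/ord_ge_evp/ord_geW/uP1.
have [r qE] := closed_field_poly_normal q.
have lcn : lead_coef q != 0 by rewrite lead_coef_eq0.
rewrite qE evp_prod => fq; apply: contrapT => noc.
have fc a : f - iota a != 0 /\ P (f - iota a) = 0.
  have [] := @ord_geNP _ _ P (f - iota a) 1; first by move=> ?; apply: noc; exists a.
  move=> fan lt; split=> //; suff /(ord_geE fan) : ord_ge P 0 (f - iota a) by ord_lia.
  by apply: ord_geB => //; exact: ord_ge_cst.
have [pn p0] := @ord_prod P _ r _ (fun a => proj1 (fc a)) (fun a => proj2 (fc a)).
have : iota (lead_coef q) * \prod_(a <- r) (f - iota a) != 0.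
  by rewrite mulf_neq0 // fmorph_eq0.
move/ord_geE => /(_ _ _ fq); rewrite ordM ?fmorph_eq0 // ord_cst // p0; lia.
Qed.

End Residue.

Section Divisors.
Variables (k : closedFieldType) (C : curve k).
Notation iota := (cst C).
Implicit Types (P Q : point C) (f g : C) (s : seq (point C)).
Implicit Types (D : {freeg (point C) / int}).
Notation L := riemann_roch_space.

(** Effective divisors are lists of points with repetition, so that induction on the list adds one
    point at a time. *)
Definition list_divisor s : {freeg (point C) / int} := \sum_(P <- s) << P >>.

Lemma coeff_list_divisor s Q : coeff Q (list_divisor s) = (count_mem Q s)%:Z.
Proof.
rewrite /list_divisor raddf_sum /=; elim: s => [|P s IHs]; first by rewrite big_nil.
by rewrite big_cons IHs coeffU mul1r /= PoszD; case: eqP.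
Qed.

Lemma deg_list_divisor s : deg (list_divisor s) = size s.
Proof.
rewrite /list_divisor raddf_sum /=; elim: s => [|P s IHs]; first by rewrite big_nil.
by rewrite big_cons IHs degU.
Qed.

Lemma abs_list D : exists s, forall Q, (count_mem Q s)%:Z = `|coeff Q D|.
Proof.
exists (flatten [seq nseq `|coeff P D| P | P <- dom D]) => Q.
rewrite count_flatten -map_comp sumnE big_map.
under eq_bigr do rewrite /= count_nseq /=.
have [Qd|Qd] := boolP (Q \in dom D).
  rewrite (bigD1_seq Q) ?uniq_dom //= eqxx mul1n big1 ?addn0 //.
  by move=> P /negPf ->; rewrite mul0n.
rewrite (coeff_outdom Qd) normr0 big_seq big1 // => P Pd.
by have [e|] := eqVneq P Q; [rewrite -e Pd in Qd|rewrite mul0n].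
Qed.

Lemma effective_list D : (forall Q, 0 <= coeff Q D) -> exists s, D = list_divisor s.
Proof.
move=> D0; have [s sD] := abs_list D; exists s; apply/eqP/freeg_eqP => Q.
by rewrite coeff_list_divisor sD ger0_norm.
Qed.

Lemma riemann_roch_spaceP D f : L D f <-> forall P, ord_ge P (- coeff P D) f.
Proof.
split=> [[->|fD] P|fD]; [by left|by right|].
by have [->|fn] := eqVneq f 0; [left|right=> P; apply: ord_geE (fD P)].
Qed.

Hypothesis residues :
  forall P f, ord_ge P 0 f -> exists c, ord_ge P 1 (f - iota c).

(** The leading coefficient at P is a linear form with values in k. Subtracting suitable constant
    multiples of one basis element of order exactly m kills it on all the others. *)
Lemma dim_drop (V : C -> Prop) P m r :
  (forall f g c, V f -> V g -> V (f - iota c * g)) ->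
  (forall f, V f -> ord_ge P m f) -> dim_ge (constants iota) V r.+1 ->
  dim_ge (constants iota) (fun f => V f /\ ord_ge P (m + 1) f) r.
Proof.
move=> VB Vm [c Vc frc].
have cst0 : constants iota 0 by exists 0; rewrite rmorph0.
have cstM x y : constants iota x -> constants iota y -> constants iota (x * y).
  exact: (subM (constants_sub iota)).
have [call|] := pselect (forall i, ord_ge P (m + 1) (c i)).
  exists (fun j => c (lift ord_max j)) => [j|a Ea sa0 j]; first by split.
  pose a' i := if unlift ord_max i is Some j then a j else 0.
  have := frc a' _ _ (lift ord_max j); rewrite /a' liftK; apply.
    by move=> i; case: unliftP => [j' _|_].
  rewrite (bigD1_ord ord_max) //= unlift_none mul0r add0r -[RHS]sa0.
  by apply: eq_bigr => i _; rewrite liftK.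
move/existsNP => [i0 /ord_geNP[cn0 lt]].
have Pc0 : P (c i0) = m by have := ord_geE cn0 (Vm _ (Vc i0)); ord_lia.
have /choice[e eP] : forall i, exists e, ord_ge P 1 (c i / c i0 - iota e).
  move=> i; apply: residues; rewrite -(subrr m); apply: ord_geM; first exact: Vm.
  by right; rewrite ordV Pc0.
exists (fun j => c (lift i0 j) - iota (e (lift i0 j)) * c i0) => [j|a Ea sa0 j].
  split; first exact: VB.
  have -> : c (lift i0 j) - iota (e (lift i0 j)) * c i0 =
      c i0 * (c (lift i0 j) / c i0 - iota (e (lift i0 j))) by field.
  by apply: ord_geM => //; right; rewrite Pc0.
(* The coefficients of the original relation: [c i0] collects what was subtracted from all the other
   members. *)
pose a' i := if unlift i0 i is Some j then a j
             else - \sum_j a j * iota (e (lift i0 j)).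
have := frc a' _ _ (lift i0 j); rewrite /a' liftK; apply.
  move=> i; case: unliftP => [j' _|_] //; apply: (subN (constants_sub iota)).
  by apply: (sub_sum (constants_sub iota)) => j'; apply: cstM => //; eexists.
rewrite (bigD1_ord i0) //= unlift_none -[RHS]sa0 mulNr mulr_suml -sumrN -big_split.
by apply: eq_bigr => i _ /=; rewrite liftK; ring.
Qed.

Lemma riemann_roch_drop1 D P r :
  dim_ge (constants iota) (L (D + << P >>)) r.+1 -> dim_ge (constants iota) (L D) r.
Proof.
move=> dimD; pose m := - coeff P (D + << P >>).
have := @dim_drop (L (D + << P >>)) P m r _ _ dimD; move=> H.
apply: dim_ge_sub (H _ _).
- move=> f [/riemann_roch_spaceP fD fP]; apply/riemann_roch_spaceP => Q.
  have [<-|PQ] := eqVneq P Q.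
    by move: fP; rewrite /m coeffD coeffU eqxx mul1r opprD subrK.
  by have := fD Q; rewrite coeffD coeffU (negPf PQ) mulr0 addr0.
- move=> f g c /riemann_roch_spaceP fD /riemann_roch_spaceP gD.
  by apply/riemann_roch_spaceP => Q; apply/ord_geB/ord_geZ.
- by move=> f /riemann_roch_spaceP.
Qed.

Lemma riemann_roch_drop D D' r : (forall P, coeff P D <= coeff P D') ->
  dim_ge (constants iota) (L D') r ->
  exists2 s, dim_ge (constants iota) (L D) s & r%:Z - deg (D' - D) <= s%:Z.
Proof.
move=> le; have [|s Es] := @effective_list (D' - D).
  by move=> Q; rewrite coeffB subr_ge0.
have D'E : D' = D + list_divisor s by rewrite -Es addrC subrK.
rewrite Es deg_list_divisor D'E {Es D'E le}.
elim: s r => [|P s IHs] r.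
  by rewrite /list_divisor big_nil addr0 => dimD; exists r; rewrite ?subr0.
rewrite /list_divisor big_cons addrCA addrC; case: r => [_|r].
  (* At dimension zero nothing more can be lost; the integer inequality leaves room for this. *)
  exists 0%N => //; exists (fun _ => 0) => [[]//|a _ _ []//].
move/riemann_roch_drop1/IHs => [t dimD le]; exists t => //; move: le; rewrite /=; lia.
Qed.

End Divisors.

(** * Superelliptic models *)

Section AffineModel.
Variables (k : closedFieldType) (C : curve k) (x : C).
Notation iota := (cst C).

Lemma eval_xyE y (P : {poly {poly k}}) :
  eval_xy x y P = (map_poly (evp iota x) P).[y].
Proof.
rewrite /eval_xy; elim/poly_ind: P => [|P c IH]; first by rewrite !rmorph0 !horner0.
by rewrite !rmorphD !rmorphM /= !map_polyX !map_polyC !hornerE /= IH.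
Qed.

Lemma eval_xy_zmod_morphism y : zmod_morphism (@eval_xy k C x y).
Proof. by move=> P Q; rewrite !eval_xyE rmorphB hornerD hornerN. Qed.
Lemma eval_xy_monoid_morphism y : monoid_morphism (@eval_xy k C x y).
Proof. by split=> [|P Q]; rewrite !eval_xyE ?rmorph1 ?hornerC // rmorphM hornerM. Qed.
HB.instance Definition _ y :=
  GRing.isZmodMorphism.Build _ _ (@eval_xy k C x y) (eval_xy_zmod_morphism y).
HB.instance Definition _ y :=
  GRing.isMonoidMorphism.Build _ _ (@eval_xy k C x y) (eval_xy_monoid_morphism y).

Lemma eval_xyC y p : eval_xy x y p%:P = evp iota x p.
Proof. by rewrite eval_xyE map_polyC hornerC. Qed.

Lemma eval_xyX y : eval_xy x y 'X = y.
Proof. by rewrite eval_xyE map_polyX hornerX. Qed.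

Lemma eval_xy_scale y c P :
  eval_xy x y (P \Po (c%:P *: 'X)) = eval_xy x (iota c * y) P.
Proof.
by rewrite !eval_xyE map_comp_poly horner_comp map_polyZ map_polyX hornerZ hornerX
  /= evpC.
Qed.

Variables (n : nat) (h : {poly k}) (y : C).
Hypothesis n0 : (0 < n)%N.
Hypothesis model : affine_model n h x y.

Lemma model_eq : y ^+ n = evp iota x h.
Proof.
have [/(_ ('X^n - h%:P)) [_ ker] _] := model.
have : eval_xy x y ('X^n - h%:P) = 0 by apply: ker; exists 1; rewrite mul1r.
by rewrite rmorphB rmorphXn /= eval_xyC eval_xyX => /eqP; rewrite subr_eq0 => /eqP.
Qed.

(** A relation p(x) = 0 would make p, which is constant in Y, a multiple of Y^n - h. *)
Lemma model_transc : ~ algebraicOver iota x.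
Proof.
case=> p pn /eqP px; have [/(_ p%:P) [ker _] _] := model.
have [|Q pQ] := ker; first by rewrite eval_xyC.
move: pn; rewrite -polyC_eq0 pQ => /negP; apply; rewrite mulf_eq0; apply/orP; left.
apply: contraT => Qn; have := size_polyC_leq1 p; rewrite pQ size_mul //; last first.
  by rewrite -size_poly_eq0 size_XnsubC.
rewrite size_XnsubC // addnS /= leqNgt => /negP[].
by apply: (@leq_add 1 1) => //; rewrite lt0n size_poly_eq0.
Qed.

Lemma model_spans z : spans (ratfield iota x) (fun j : 'I_n => y ^+ j) z.
Proof.
have [_ /(_ z)[P [Q [Qn ->]]]] := model; rewrite !eval_xyE in Qn *.
have coefR (R : {poly {poly k}}) i : ratfield iota x (map_poly (evp iota x) R)`_i.
  by rewrite coef_map; apply: ratfield_evp.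
apply: (@span_powers _ _ (ratfield_sub iota x) _ (map_poly (evp iota x) ('X^n -
  h%:P))) => //.
- exact/monic_map/monicXnsubC.
- by rewrite rmorphB /= map_polyXn map_polyC size_XnsubC.
- rewrite /root -eval_xyE rmorphB rmorphXn /= eval_xyC eval_xyX model_eq subrr.
  exact: eqxx.
Qed.

(** (x, c y) satisfies the equation of the model, which gives one inclusion of kernels; c^-1 gives
    the other. *)
Lemma model_twist_ker c P : c ^+ n = 1 ->
  eval_xy x y P = 0 <-> eval_xy x (iota c * y) P = 0.
Proof.
have main d R : d ^+ n = 1 -> eval_xy x y R = 0 -> eval_xy x (iota d * y) R = 0.
  move=> dn; have [/(_ R)[ker _] _] := model; move=> /ker[Q ->].
  rewrite rmorphM rmorphB rmorphXn /= eval_xyC eval_xyX exprMn -rmorphXn dn rmorph1.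
  by rewrite mul1r model_eq subrr mulr0.
move=> cn; split; first exact: main.
rewrite -eval_xy_scale => /(main c^-1); rewrite exprVn cn invr1 => /(_ erefl).
rewrite eval_xy_scale mulrA -rmorphM mulfV ?rmorph1 ?mul1r //.
apply: contra_eq_neq cn => ->; rewrite expr0n gtn_eqF //= eq_sym.
exact: oner_neq0.
Qed.

Lemma model_automorphism c : c ^+ n = 1 -> exists tau : {rmorphism C -> C},
  [/\ forall a, tau (iota a) = iota a, tau x = x & tau y = iota c * y].
Proof.
move=> cn; pose e := eval_xy x y; pose e' := eval_xy x (iota c * y).
(* The graph of the substitution y -> c y on fractions. It is functional because both evaluations
   have the same kernel. *)
pose R z w := exists P Q, [/\ e Q != 0, z = e P / e Q & w = e' P / e' Q].
have e'n Q : e Q != 0 -> e' Q != 0.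
  by apply: contra_neq => /(model_twist_ker _ cn).
have uniqR z w w' : R z w -> R z w' -> w = w'.
  move=> [P [Q [Qn -> ->]]] [P' [Q' [Q'n eq ->]]].
  apply/eqP; rewrite eqr_div ?e'n // -subr_eq0 -!rmorphM -rmorphB; apply/eqP.
  apply/(model_twist_ker _ cn); rewrite rmorphB !rmorphM /=; apply/eqP.
  by rewrite subr_eq0 -eqr_div //; apply/eqP.
have RB z w z' w' : R z w -> R z' w' -> R (z - z') (w - w').
  move=> [P [Q [Qn -> ->]]] [P' [Q' [Q'n -> ->]]]; exists (P * Q' - P' * Q), (Q * Q').
  have := e'n _ Qn; have := e'n _ Q'n; rewrite /e /e' in Qn Q'n * => nQ nQ'.
  rewrite !rmorphB !rmorphM mulf_neq0 //=; split=> //; field; by apply/andP.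
have RM z w z' w' : R z w -> R z' w' -> R (z * z') (w * w').
  move=> [P [Q [Qn -> ->]]] [P' [Q' [Q'n -> ->]]]; exists (P * P'), (Q * Q').
  have := e'n _ Qn; have := e'n _ Q'n; rewrite /e /e' in Qn Q'n * => nQ nQ'.
  rewrite !rmorphM mulf_neq0 //=; split=> //; field; by apply/andP.
have Re P : R (e P) (e' P).
  by exists P, 1; rewrite /e /e' !rmorph1 !divr1; split=> //; exact: oner_neq0.
have /choice[tau tauP] : forall z, exists w, R z w.
  move=> z; have [_ /(_ z)[P [Q [Qn ->]]]] := model.
  by exists (e' P / e' Q), P, Q.
have tauE z w : R z w -> tau z = w by apply: uniqR.
have tauB : zmod_morphism tau by move=> z w; apply/tauE/RB.
have tauM : monoid_morphism tau.
  split=> [|z w]; last exact/tauE/RM.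
  by apply: tauE; have := Re 1; rewrite /e /e' !rmorph1.
pose T : {rmorphism C -> C} := HB.pack tau
  (GRing.isZmodMorphism.Build _ _ tau tauB) (GRing.isMonoidMorphism.Build _ _ tau tauM).
exists T; split=> [a||] /=; apply: tauE.
- by have := Re (a%:P)%:P; rewrite /e /e' !eval_xyC evpC.
- by have := Re ('X)%:P; rewrite /e /e' !eval_xyC evpX.
- by have := Re 'X; rewrite /e /e' !eval_xyX.
Qed.

End AffineModel.

Section PullBack.
Variables (k : closedFieldType) (C : curve k) (tau sigma : {rmorphism C -> C}).
Hypothesis tauC : forall a, tau (cst C a) = cst C a.
Hypothesis sigmaK : cancel sigma tau.

(** Composition with [tau] keeps the valuation normalized because [tau] is onto: [sigma] carries a
    uniformizer of Q to one of Q'. *)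
Lemma point_pullback (Q : point C) : exists Q' : point C, forall f, Q' f = Q (tau f).
Proof.
have v0 : Q (tau 0) = 0 by rewrite rmorph0 Defs.ord0.
have vM f g : f != 0 -> g != 0 -> Q (tau (f * g)) = Q (tau f) + Q (tau g).
  by move=> fn gn; rewrite rmorphM ordM ?fmorph_eq0.
have vD f g : f != 0 -> g != 0 -> f + g != 0 ->
    Num.min (Q (tau f)) (Q (tau g)) <= Q (tau (f + g)).
  by move=> fn gn fgn; rewrite rmorphD; apply: ordD; rewrite -?rmorphD ?fmorph_eq0.
have vC c : c != 0 -> Q (tau (cst C c)) = 0 by move=> cn; rewrite tauC ord_cst.
have vt : exists2 t, t != 0 & Q (tau t) = 1.
  have [t tn t1] := ord_uniformizer Q; exists (sigma t); last by rewrite sigmaK.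
  by rewrite fmorph_eq0.
by exists (Point (ord := fun f => Q (tau f)) v0 vM vD vC vt).
Qed.

End PullBack.

(* Values at a point over a simple root of [h]. *)
Section SimpleRoot.
Variables (k : closedFieldType) (C : curve k) (n : nat) (h : {poly k}) (x y : C).
Notation iota := (cst C).
Hypothesis n0 : (0 < n)%N.
Hypothesis sep_h : separable_poly h.
Hypothesis xy : y ^+ n = evp iota x h.
Hypothesis x_transc : ~ algebraicOver iota x.

Let sep_neq0 : h != 0 := separable_poly_neq0 sep_h.

Lemma y_neq0 : y != 0.
Proof.
apply: contra_eq_neq xy => ->; rewrite expr0n gtn_eqF //= eq_sym.
by apply: transc_evp x_transc _ _; exact: sep_neq0.
Qed.

Lemma xsub_neq0 c : x - iota c != 0.
Proof. by rewrite -evpXsubC; apply: transc_evp x_transc _ _; rewrite polyXsubC_eq0. Qed.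

Lemma ord_y (Q : point C) : n%:Z * Q y = Q (evp iota x h).
Proof. by rewrite -xy ordXn ?y_neq0 // mulrC. Qed.

(** By separability a is a simple root, so h(x) has the order of x - a at Q. *)
Lemma ord_y_root (Q : point C) a : root h a -> 0 < Q (x - iota a) ->
  n%:Z * Q y = Q (x - iota a).
Proof.
move=> ha Qa; rewrite ord_y; case/factor_theorem: (ha) => h1 hE.
have h1a : h1.[a] != 0 by move: sep_h; rewrite hE separable_root => /andP[].
have [|h1n v1] := @ord_evp_at _ _ Q x a h1 _ h1a; first by right; ord_lia.
by rewrite hE rmorphM /= evpXsubC ordM ?xsub_neq0 // v1 add0r.
Qed.

Lemma ord_y_nonroot (Q : point C) b : ~~ root h b -> 0 < Q (x - iota b) -> Q y = 0.
Proof.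
move=> hb Qb; have [|_ v0] := @ord_evp_at _ _ Q x b h _ hb; first by right; ord_lia.
by have := ord_y Q; rewrite v0 => /eqP; rewrite mulf_eq0 => /orP[|/eqP //]; lia.
Qed.

Lemma ord_y_pole (Q : point C) : Q x < 0 -> n%:Z * Q y = (size h).-1%:Z * Q x.
Proof.
move=> Qx; have xn : x != 0 by have := xsub_neq0 0; rewrite rmorph0 subr0.
by rewrite ord_y; have [_ ->] := ord_evp_pole xn Qx sep_neq0.
Qed.

(** At P the orders of nonzero polynomials in x are multiples of P(x - a) = n P(y), so the orders of
    the terms differ modulo n P(y). *)
Lemma powers_free a (P : point C) (r : 'I_n -> {poly k}) :
  root h a -> 0 < P (x - iota a) ->
  \sum_j evp iota x (r j) * y ^+ j = 0 -> forall j, r j = 0.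
Proof.
move=> ha Pa sr0 j; apply/eqP; apply: contra_eqT sr0 => rj.
have vx i : r i != 0 -> exists N : nat, P (evp iota x (r i)) = N%:Z * P (x - iota a).
  move=> ri; have -> : evp iota x (r i) = evp iota (x - iota a) (r i \Po ('X + a%:P)).
    by rewrite evp_comp rmorphD /= evpX evpC subrK.
  apply: (proj2 (ord_evp (xsub_neq0 a) Pa _)).
  by rewrite -size_poly_eq0 size_comp_poly2 ?size_poly_eq0 // size_XaddC.
have vy := ord_y_root ha Pa.
have [||+ _] := @ord_sum_distinct _ _ P _ (fun i => evp iota x (r i) * y ^+ i) _ j.
- move=> i l; rewrite !mulf_eq0 !negb_or => /andP[ri yi] /andP[rl yl].
  have rin : r i != 0 by apply: contraNneq ri => ->; rewrite rmorph0.
  have rln : r l != 0 by apply: contraNneq rl => ->; rewrite rmorph0.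
  rewrite !ordM // !ordXn ?y_neq0 //.
  have [N ->] := vx _ rin; have [N' ->] := vx _ rln; rewrite -vy => e.
  apply/val_inj; have Py : 0 < P y by move: Pa; rewrite -vy pmulr_rgt0 ?ltz_nat.
  have : (N * n + i = N' * n + l)%N.
    apply/eqP; rewrite -eqz_nat; apply/eqP/(mulIf (lt0r_neq0 Py)).
    rewrite !PoszD !PoszM; move: e; clear; move: (P y) => p e.
    by transitivity (N%:Z * (n%:Z * p) + p * i%:Z); [ring|rewrite e; ring].
  move/(congr1 (modn^~ n)); rewrite !modnMDl !modn_small //.
- by rewrite mulf_neq0 ?expf_neq0 ?y_neq0 //; apply: transc_evp x_transc _ _.
by [].
Qed.

End SimpleRoot.

(** * The genus of a superelliptic curve *)

(* The ceiling of j m / n. *)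
Definition ceil_mul (n m j : nat) := ((j * m + n.-1) %/ n)%N.

(** The subtraction is truncated; by [sum_ceil_mul_ge] nothing is cut off when m > 0. *)
Definition model_genus (n m : nat) := ((\sum_(j < n) ceil_mul n m j).+1 - n)%N.

Lemma ceil_mulP n m j : (0 < n)%N ->
  (j * m <= n * ceil_mul n m j < j * m + n)%N.
Proof.
move=> n0; rewrite /ceil_mul; have := divn_eq (j * m + n.-1) n.
have := ltn_pmod (j * m + n.-1) n0.
set q := (_ %/ _)%N; set r := (_ %% _)%N; rewrite mulnC.
by move: n0; case: (n) => // n' _; lia.
Qed.

Lemma ceil_mul0 n m : (0 < n)%N -> ceil_mul n m 0 = 0%N.
Proof. by move=> n0; rewrite /ceil_mul mul0n add0n divn_small // ltn_predL. Qed.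

Lemma sum_ceil_mulE n m : (0 < n)%N ->
  (\sum_(j < n) ceil_mul n m j = \sum_(1 <= j < n) ceil_mul n m j)%N.
Proof.
move=> n0; rewrite -(big_mkord xpredT (ceil_mul n m)) big_ltn //.
by rewrite ceil_mul0 // add0n.
Qed.

Lemma sum_ceil_mul_ge n m : (0 < n)%N -> (0 < m)%N ->
  (n <= (\sum_(j < n) ceil_mul n m j).+1)%N.
Proof.
move=> n0 m0; rewrite sum_ceil_mulE //.
have {1}-> : n = (\sum_(1 <= j < n) 1).+1%N by rewrite sum_nat_const_nat muln1; lia.
rewrite ltnS big_nat [leqRHS]big_nat; apply: leq_sum => j /andP[j0 _].
have /andP[le _] := ceil_mulP m j n0.
rewrite lt0n; apply: contraTneq le => ->; rewrite muln0 leqn0 muln_eq0.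
by rewrite negb_or -!lt0n j0.
Qed.

(** Pairing j with n - j pays off because the two ceilings add up to m if n divides j m, and to m +
    1 otherwise. *)
Lemma sum_ceil_mul_sym n m : (0 < n)%N ->
  (2 * \sum_(j < n) ceil_mul n m j =
   \sum_(1 <= j < n) (ceil_mul n m j + ceil_mul n m (n - j)))%N.
Proof.
move=> n0; rewrite big_split /= mul2n -addnn sum_ceil_mulE //; congr (_ + _)%N.
by rewrite big_nat_rev; apply: eq_bigr.
Qed.

(** Such sums count the exceptional j with n dividing j m: 2 j = n for m = 2, and 3 j = n or 3 j = 2
    n for m = 3. *)
Lemma sum_eqn_le1 (n d e : nat) : (0 < d)%N -> (\sum_(1 <= j < n) (d * j == e) <= 1)%N.
Proof.
move=> d0; case: (posnP n) => [->|n0]; first by rewrite big_geq.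
rewrite -[n]prednK // big_add1 /= big_mkord.
have [[j ej]|nj] := pselect (exists j : 'I_n.-1, (d * j.+1 == e)%N).
  rewrite (bigD1 j) //= ej big1 // => i ij.
  apply/eqP; rewrite eqb0; apply: contra ij => ei.
  by rewrite -val_eqE -eqSS -(eqn_pmul2l d0) (eqP ei) (eqP ej).
by rewrite big1 // => j _; case: eqP => // ej; case: nj; exists j; apply/eqP.
Qed.

Lemma sum_eqn1 (n d q : nat) : (0 < d)%N -> (0 < q < n)%N ->
  (\sum_(1 <= j < n) (d * j == d * q) = 1)%N.
Proof.
move=> d0 /andP[q0 qn]; rewrite (@big_cat_nat _ _ _ q) //=; last exact: ltnW.
rewrite [X in (_ + X)%N]big_ltn // eqxx big1_seq => [|j].
  rewrite big1_seq // => j; rewrite mem_index_iota /= => /andP[lt _].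
  by rewrite eqn_pmul2l // gtn_eqF.
by rewrite mem_index_iota /= => /andP[_ lt]; rewrite eqn_pmul2l // ltn_eqF.
Qed.

Lemma model_genus1 n : (0 < n)%N -> model_genus n 1 = 0%N.
Proof.
move=> n0; apply/eqP; rewrite /model_genus subn_eq0 sum_ceil_mulE //.
apply: (@leq_ltn_trans (\sum_(1 <= j < n) 1)); last first.
  by rewrite sum_nat_const_nat muln1; lia.
rewrite big_nat [leqRHS]big_nat; apply: leq_sum => j /andP[_ jn].
have /andP[_ lt] := ceil_mulP 1 j n0; rewrite -ltnS -(ltn_pmul2l n0).
by apply: leq_trans lt _; lia.
Qed.

Lemma ceil_mul2_sym n j : (0 < j < n)%N ->
  (ceil_mul n 2 j + ceil_mul n 2 (n - j) + (2 * j == n) = 3)%N.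
Proof.
move=> /andP[j0 jn]; have n0 : (0 < n)%N by exact: leq_trans jn.
have := ceil_mulP 2 j n0; have := ceil_mulP 2 (n - j) n0.
move: (ceil_mul n 2 j) (ceil_mul n 2 (n - j)) => c d /andP[d1 d2] /andP[c1 c2].
have c3 : (0 < c < 3)%N by nia.
have d3 : (0 < d < 3)%N by nia.
have cc : c = 1%N \/ c = 2%N by lia.
have dd : d = 1%N \/ d = 2%N by lia.
by case: cc c1 c2 {c3} => ->; case: dd d1 d2 {d3} => ->; lia.
Qed.

Lemma ceil_mul3_sym n j : (0 < j < n)%N ->
  (ceil_mul n 3 j + ceil_mul n 3 (n - j) + (3 * j == n) + (3 * j == 2 * n) = 4)%N.
Proof.
move=> /andP[j0 jn]; have n0 : (0 < n)%N by exact: leq_trans jn.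
have := ceil_mulP 3 j n0; have := ceil_mulP 3 (n - j) n0.
move: (ceil_mul n 3 j) (ceil_mul n 3 (n - j)) => c d /andP[d1 d2] /andP[c1 c2].
have c3 : (0 < c < 4)%N by nia.
have d3 : (0 < d < 4)%N by nia.
have cc : c = 1%N \/ c = 2%N \/ c = 3%N by lia.
have dd : d = 1%N \/ d = 2%N \/ d = 3%N by lia.
by case: cc c1 c2 {c3} => [|[]] ->; case: dd d1 d2 {d3} => [|[]] ->; lia.
Qed.

Lemma model_genus2 n : (0 < n)%N -> (n <= 2 * model_genus n 2 + 2)%N.
Proof.
move=> n0; have : (3 * n.-1 <= 2 * (\sum_(j < n) ceil_mul n 2 j) + 1)%N.
  rewrite sum_ceil_mul_sym //; apply: leq_trans (leq_add (leqnn _) (sum_eqn_le1 n n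
    (isT : 0 < 2)%N)).
  rewrite -big_split /= -subn1 mulnC -sum_nat_const_nat.
  rewrite big_nat [leqRHS]big_nat; apply: leq_sum => j jn.
  by rewrite ceil_mul2_sym.
rewrite /model_genus; move: (\sum_(j < n) _)%N; lia.
Qed.

Lemma model_genus2_even g : model_genus (2 * g + 2) 2 = g.
Proof.
set n := (2 * g + 2)%N; have n0 : (0 < n)%N by rewrite /n; lia.
(* For even n, j = g + 1 is the one exceptional index. *)
have e1 : (\sum_(1 <= j < n) (2 * j == 2 * g.+1) = 1)%N.
  by apply: sum_eqn1 => //; rewrite /n; lia.
have : (2 * (\sum_(j < n) ceil_mul n 2 j) +
    \sum_(1 <= j < n) (2 * j == 2 * g.+1) = 3 * n.-1)%N.
  rewrite sum_ceil_mul_sym // -big_split /= -subn1 [(3 * (_ - _))%N]mulnC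
    -sum_nat_const_nat.
  rewrite big_nat [RHS]big_nat; apply: eq_bigr => j jn.
  by rewrite -(ceil_mul2_sym jn); congr (_ + (_ == _))%N; rewrite /n; lia.
rewrite e1 /model_genus; move: (\sum_(j < n) _)%N; rewrite /n; lia.
Qed.

Lemma model_genus3 n : (0 < n)%N -> (n <= model_genus n 3 + 2)%N.
Proof.
move=> n0; have : (4 * n.-1 <= 2 * (\sum_(j < n) ceil_mul n 3 j) + 1 + 1)%N.
  rewrite sum_ceil_mul_sym //.
  apply: leq_trans (leq_add (leq_add (leqnn _) (sum_eqn_le1 n n (isT : 0 < 3)%N))
    (sum_eqn_le1 n (2 * n) (isT : 0 < 3)%N)).
  rewrite -!big_split /= -subn1 mulnC -sum_nat_const_nat.
  rewrite big_nat [leqRHS]big_nat; apply: leq_sum => j jn.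
  by rewrite ceil_mul3_sym.
rewrite /model_genus; move: (\sum_(j < n) _)%N; lia.
Qed.

Lemma model_genus3_div n : (0 < n)%N -> (3 %| n)%N -> n = (model_genus n 3 + 2)%N.
Proof.
move=> n0 /dvdnP[e ne].
(* When 3 divides n, both exceptional indices n/3 and 2n/3 occur. *)
have e1 : (\sum_(1 <= j < n) (3 * j == 3 * e) = 1)%N.
  by apply: sum_eqn1 => //; lia.
have e2 : (\sum_(1 <= j < n) (3 * j == 3 * (2 * e)) = 1)%N.
  by apply: sum_eqn1 => //; lia.
have : (2 * (\sum_(j < n) ceil_mul n 3 j) + \sum_(1 <= j < n) (3 * j == 3 * e) +
    \sum_(1 <= j < n) (3 * j == 3 * (2 * e)) = 4 * n.-1)%N.
  rewrite sum_ceil_mul_sym // -!big_split /= -subn1 [(4 * (_ - _))%N]mulnC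
    -sum_nat_const_nat.
  rewrite big_nat [RHS]big_nat; apply: eq_bigr => j jn.
  by rewrite -(ceil_mul3_sym jn); congr (_ + _ + nat_of_bool _ + nat_of_bool _)%N; lia.
rewrite e1 e2 /model_genus; move: (\sum_(j < n) _)%N; lia.
Qed.

(** Each pair of ceilings adds up to at least m >= 4, so the exceptional indices need no count. *)
Lemma model_genus_ge4 n m : (0 < n)%N -> (4 <= m)%N -> (n <= model_genus n m + 2)%N.
Proof.
move=> n0 m4; have : (4 * n.-1 <= 2 * (\sum_(j < n) ceil_mul n m j))%N.
  rewrite sum_ceil_mul_sym // -subn1 mulnC -sum_nat_const_nat.
  rewrite big_nat [leqRHS]big_nat; apply: leq_sum => j /andP[_ jn].
  apply: leq_trans m4 _; rewrite -(leq_pmul2l n0) mulnDr.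
  have /andP[c1 _] := ceil_mulP m j n0; have /andP[c2 _] := ceil_mulP m (n - j) n0.
  by apply: leq_trans (leq_add c1 c2); rewrite -mulnDl subnKC // ltnW.
rewrite /model_genus; move: (\sum_(j < n) _)%N; lia.
Qed.

(** In characteristic zero X^n - 1 is separable, and among n distinct n-th roots of unity one is
    primitive. *)
Lemma prim_root_exists (k : closedFieldType) (n : nat) :
  [pchar k] =i pred0 -> (0 < n)%N -> exists z : k, n.-primitive_root z.
Proof.
move=> /pcharf0P char0 n0.
have [r rE] := closed_field_poly_normal ('X^n - 1 : {poly k}).
have lc1 : lead_coef ('X^n - 1 : {poly k}) = 1 by apply/eqP; exact: monic_Xn_sub_1.
rewrite lc1 scale1r in rE.
have sr : size r = n.
  by apply: succn_inj; rewrite -(size_prod_XsubC r id) -rE size_XnsubC.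
suff /hasP[z _ pz] : has n.-primitive_root r by exists z.
apply: has_prim_root => //; last by rewrite sr.
  by apply/allP => z zr; rewrite /root_of_unity rE root_prod_XsubC.
rewrite -separable_prod_XsubC -rE.
by rewrite separable_Xn_sub_1 // char0 -lt0n.
Qed.

(** * Functions with poles only at the point over a root of h *)

Section Genus.
Variables (k : closedFieldType) (char0 : [pchar k] =i pred0).
Variables (C : curve k) (n : nat) (h : {poly k}) (x y : C).
Notation iota := (cst C).
Hypothesis n0 : (0 < n)%N.
Hypothesis model : affine_model n h x y.
Hypothesis sep_h : separable_poly h.

Let x_transc := model_transc n0 model.
Let xy := model_eq model.
Let spans_y := model_spans n0 model.
Let yn : y != 0 := y_neq0 n0 sep_h xy x_transc.
Let xan c : x - iota c != 0 := xsub_neq0 x_transc c.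
Let m := (size h).-1.
Local Notation cdeg := (ceil_mul n m).
Let cdegP j := ceil_mulP m j n0.

Lemma transc_of_pole (Q : point C) f : Q f < 0 -> ~ algebraicOver iota f.
Proof.
move=> Qf [p pn /eqP pf]; have fn : f != 0.
  by apply: contraTneq Qf => ->; rewrite Defs.ord0.
by have [] := ord_evp_pole fn Qf pn; rewrite /evp pf eqxx.
Qed.

Lemma model_residue (Q : point C) f : ord_ge Q 0 f -> exists c, ord_ge Q 1 (f - iota c).
Proof. exact: residue_exists x_transc spans_y. Qed.

Variables (a : k) (Pa : point C).
Hypothesis ha : root h a.
Hypothesis Pa_pos : 0 < Pa (x - iota a).

Definition pole_fun := (x - iota a)^-1.
Let u := pole_fun.

Let un : u != 0. Proof. by rewrite invr_eq0. Qed.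

Lemma ratfield_xu : ratfield iota u x.
Proof.
rewrite -(subrK (iota a) x); apply: (subD (ratfield_sub _ _)); last exact: ratfield_cst.
have [E1 _ EV] := ratfield_sub iota u; rewrite -[x - _]invrK -div1r.
by apply: EV => //; apply: ratfield_id.
Qed.

Lemma ratfield_shift w c : ratfield iota (w - iota c) w.
Proof.
rewrite -{2}(subrK (iota c) w); apply: (subD (ratfield_sub _ _)).
  exact: ratfield_id.
exact: ratfield_cst.
Qed.

Let spans_shift c z : spans (ratfield iota (u - iota c)) (fun j : 'I_n => y ^+ j) z.
Proof.
apply: spans_ratfield (ratfield_shift u c) _.
exact: spans_ratfield ratfield_xu (spans_y z).
Qed.

Lemma zeros_xa (s : seq (point C)) : uniq s -> (forall Q, Q \in s ->
  0 < Q (x - iota a)) ->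
  (\sum_(Q <- s) `|Q (x - iota a)%R| <= n)%N.
Proof.
move=> us spos; rewrite -[leqRHS]card_ord.
apply: zeros_le_degree (xan a) _ us spos => z.
exact: spans_ratfield (ratfield_shift x a) (spans_y z).
Qed.

(** The order Q(x - a) = n Q(y) is a positive multiple of n, and it is at most n because F has
    degree at most n over k(x). *)
Lemma ord_over_root (Q : point C) : 0 < Q (x - iota a) ->
  Q (x - iota a) = n%:Z /\ Q y = 1.
Proof.
move=> Qa; have vy := ord_y_root n0 sep_h xy x_transc ha Qa.
have := @zeros_xa [:: Q] isT; rewrite big_seq1 => le.
have {}le : (`|Q (x - iota a)%R| <= n)%N by apply: le => Q'; rewrite inE => /eqP ->.
move: Qa le; rewrite -vy; rewrite pmulr_rgt0 ?ltz_nat // => e0.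
rewrite abszM absz_nat -[leqRHS]muln1 leq_pmul2l // => e1.
by have -> : Q y = 1; [ord_lia|rewrite mulr1].
Qed.

Lemma root_point_unique (Q : point C) : 0 < Q (x - iota a) -> Q = Pa.
Proof.
move=> Qa; apply/eqP; apply: contraT => QP.
have [vQ _] := ord_over_root Qa; have [vP _] := ord_over_root Pa_pos.
have := @zeros_xa [:: Q; Pa]; rewrite /= inE QP big_cons big_seq1 vQ vP => /(_ isT) le.
have {le} : (n + n <= n)%N by apply: le => Q'; rewrite !inE => /orP[]/eqP->.
by rewrite -[leqRHS]addn0 leq_add2l leqNgt n0.
Qed.

Lemma ord_Pa_u : Pa u = - n%:Z.
Proof. by rewrite ordV; have [->] := ord_over_root Pa_pos. Qed.

Lemma u_shift_neq0 c : u - iota c != 0 /\ Pa (u - iota c) = - n%:Z.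
Proof.
rewrite -ord_Pa_u; apply: ord_addl => //; apply/ord_geN/ord_geW/ord_ge_cst.
by rewrite ord_Pa_u; lia.
Qed.

Lemma u_shift_zero c : exists Q : point C, 0 < Q (u - iota c).
Proof.
apply: (zero_exists _ (spans_shift c)); apply: (@transc_of_pole Pa).
by have [_ ->] := u_shift_neq0 c; rewrite oppr_lt0 ltz_nat.
Qed.

(** The point lies over infinity or over a finite b. The order of y is recorded up to the factor n,
    which avoids computing the ramification of x. *)
Lemma point_cases (Q : point C) : Q != Pa ->
  (Q x < 0 /\ Q u = - Q x /\ n%:Z * Q y = m%:Z * Q x) \/
  exists b, [/\ 0 < Q (x - iota b), Q u = 0 & Q y = 0 \/ n%:Z * Q y = Q (x - iota b)].
Proof.
move=> QP; have Qa : Q (x - iota a) <= 0.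
  by rewrite leNgt; apply: contra QP => /root_point_unique ->.
have xn : x != 0 by have := xan 0; rewrite rmorph0 subr0.
have [Qx|Qx] := ltP (Q x) 0.
  left; split=> //; split; last exact: (ord_y_pole n0 sep_h xy x_transc Qx).
  rewrite ordV; have [_ ->//] : x - iota a != 0 /\ Q (x - iota a) = Q x.
  by apply: ord_addl => //; apply/ord_geN/ord_geW/ord_ge_cst; ord_lia.
right; have [b /(ord_geE (xan b)) Qb] := model_residue (ord_ge_le Qx).
have {}Qb : 0 < Q (x - iota b) by ord_lia.
exists b; split=> //.
  have : ord_ge Q 0 (x - iota a) by apply: ord_geB; [right|exact: ord_ge_cst].
  by move/(ord_geE (xan a)); rewrite ordV; ord_lia.
have [hb|hb] := boolP (root h b); first by right;
  exact: (ord_y_root n0 sep_h xy x_transc hb Qb).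
by left; exact: (ord_y_nonroot n0 sep_h xy x_transc hb Qb).
Qed.

Lemma ord_ge_u (Q : point C) : Q != Pa -> ord_ge Q 0 u.
Proof. by move=> /point_cases[[? [? _]]|[b [_ ? _]]]; right; ord_lia. Qed.

(** Over infinity, n times the order of u^c y^j is (n c - m j) times the pole order of x, so the
    ceiling [cdeg j] is the least exponent that makes it regular there. *)
Definition wfun (j : nat) : C := u ^+ cdeg j * y ^+ j.

Lemma wfun_neq0 j : wfun j != 0.
Proof. by rewrite mulf_neq0 ?expf_neq0. Qed.

Lemma ord_wfun (Q : point C) j : n%:Z * Q (wfun j) = n%:Z * Q u * cdeg j + n%:Z * Q
  y * j%:Z.
Proof. by rewrite ordM ?expf_neq0 // !ordXn //; ring. Qed.

Lemma ord_wfun_ge0 (Q : point C) j : Q != Pa -> 0 <= Q (wfun j).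
Proof.
move=> QP; suff : 0 <= n%:Z * Q (wfun j) by rewrite pmulr_rge0 ?ltz_nat.
rewrite ord_wfun; have /andP[le _] := cdegP j.
have [[Qx [-> ->]]|[b [Qb -> [->|->]]]] := point_cases QP.
- by move: Qx; move: (Q x) => e e0; nia.
- by rewrite mulr0 !mul0r.
- by rewrite mulr0 mul0r add0r mulr_ge0 // ltW.
Qed.

(** This forbids u - c as a denominator. Over infinity it follows from n c_j - m j < n, and over a
    finite point from j < n. *)
Lemma ord_wfun_lt (Q : point C) j c : (j < n)%N -> Q != Pa -> 0 < Q (u - iota c) ->
  Q (wfun j) < Q (u - iota c).
Proof.
move=> jn QP Qc; suff : n%:Z * Q (wfun j) < n%:Z * Q (u - iota c).
  by rewrite ltr_pM2l ?ltz_nat.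
rewrite ord_wfun; have /andP[_ lt] := cdegP j.
have cE : ord_ge Q 1 u -> c = 0.
  move=> Qu; apply/eqP; apply: contraT => cn.
  have : ord_ge Q 1 (iota c).
    have -> : iota c = u - (u - iota c) by rewrite subKr.
    by apply: ord_geB => //; right; ord_lia.
  by move/ord_geE; rewrite fmorph_eq0 ord_cst // => /(_ cn).
have [[Qx [Qu ->]]|[b [Qb Qu Qy]]] := point_cases QP.
  have /cE c0 : ord_ge Q 1 u by right; ord_lia.
  rewrite c0 rmorph0 subr0 Qu; move: Qx; move: (Q x) => e e0; nia.
rewrite Qu mulr0 mul0r add0r; have [->|Qyb] := Qy.
  by rewrite mulr0 mul0r mulr_gt0 // ltz_nat.
have cn : c != 0.
  apply: contraTneq Qc => ->; rewrite rmorph0 subr0 Qu; by [].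
have icn : iota c != 0 by rewrite fmorph_eq0.
(* u = c is equivalent to x = a + 1/c, so u - c vanishes at Q exactly as x - b' does. *)
pose b' := a + c^-1.
have uE : u - iota c = - iota c * u * (x - iota b').
  rewrite /b' rmorphD fmorphV /u /pole_fun; field; by rewrite icn xan.
have vb' : Q (x - iota b') = Q (u - iota c).
  by rewrite uE !ordM ?oppr_eq0 ?mulf_neq0 ?oppr_eq0 // ordN ord_cst // Qu add0r.
have bb : b = b'.
  apply/eqP; apply: contraT; rewrite -subr_eq0 => bn.
  have : ord_ge Q 1 (iota (b - b')).
    have -> : iota (b - b') = (x - iota b') - (x - iota b) by rewrite rmorphB; ring.
    by apply: ord_geB; right; ord_lia.
  by move/ord_geE; rewrite fmorph_eq0 ord_cst // => /(_ bn).
rewrite Qyb bb vb' [ltRHS]mulrC ltr_pM2l // ltz_nat //.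
Qed.

Lemma tau_ratfield (tau : {rmorphism C -> C}) f :
  (forall c, tau (iota c) = iota c) -> tau x = x -> ratfield iota x f -> tau f = f.
Proof.
move=> tc tx [p [q [_ ->]]]; rewrite -!/(evp _ _ _) fmorph_div.
have tp r : tau (evp iota x r) = evp iota x r.
  rewrite evpE rmorph_sum; apply: eq_bigr => i _.
  by rewrite rmorphM rmorphXn tc tx.
by rewrite !tp.
Qed.

Let regular z := forall Q : point C, Q != Pa -> ord_ge Q 0 z.

(** The automorphism fixes x, hence permutes the points over a; as [Pa] is the only one, the points
    other than [Pa] are permuted too. *)
Lemma regular_tau c z : c ^+ n = 1 -> exists tau : {rmorphism C -> C},
  [/\ forall b, tau (iota b) = iota b, tau x = x, tau y = iota c * y &
      regular z -> regular (tau z)].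
Proof.
move=> cn; have [tau [tc tx ty]] := model_automorphism n0 model cn.
exists tau; split=> // zreg Q QP.
have [|sigma [sc sx sy]] := @model_automorphism _ _ _ _ _ _ n0 model c^-1.
  by rewrite exprVn cn invr1.
have cn0 : c != 0.
  by apply: contra_eq_neq cn => ->; rewrite expr0n gtn_eqF //= eq_sym oner_neq0.
have sigmaK : cancel sigma tau.
  move=> w; have [f fx ->] := spans_y w; rewrite !rmorph_sum; apply: eq_bigr => i _.
  rewrite !rmorphM !rmorphXn sy rmorphM tc ty mulrA -rmorphM mulVf // rmorph1 mul1r.
  by rewrite (tau_ratfield sc sx (fx i)) (tau_ratfield tc tx (fx i)).
have [Q' Q'E] := point_pullback tc sigmaK Q.
have Q'P : Q' != Pa.
  apply: contra QP => /eqP Q'P; apply/eqP/root_point_unique.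
  by move: Pa_pos; rewrite -Q'P Q'E rmorphB tx tc.
by have [->|le] := zreg _ Q'P; [rewrite rmorph0; left|right; rewrite -Q'E].
Qed.

(* [n f_l y^l] is the sum of [zeta^(-i l) tau_i z] over i < n, where [tau_i]
   multiplies [y] by [zeta^i]. *)
Lemma regular_coeff z (f : 'I_n -> C) : regular z ->
  (forall j, ratfield iota x (f j)) -> z = \sum_j f j * y ^+ j ->
  forall l, regular (f l * y ^+ l).
Proof.
move=> zreg fx zE l Q QP; have [zeta zetaP] := prim_root_exists char0 n0.
have zn i : (zeta ^+ i) ^+ n = 1 by rewrite -exprM mulnC exprM (prim_expr_order
  zetaP) expr1n.
have zeta0 : zeta != 0.
  by apply: contra_eq_neq (prim_expr_order zetaP) => ->;
    rewrite expr0n gtn_eqF //= eq_sym oner_neq0.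
have /choice[tau tauP] := fun i : 'I_n => regular_tau z (zn i).
have sumE : \sum_(i < n) iota ((zeta ^+ i) ^- l) * tau i z = iota n%:R * (f l * y ^+ l).
  transitivity (\sum_(j < n) (\sum_(i < n) iota ((zeta ^+ j / zeta ^+ l) ^+ i)) *
    (f j * y ^+ j)).
    under [RHS]eq_bigr do rewrite mulr_suml.
    rewrite exchange_big; apply: eq_bigr => i _; have [tc tx ty _] := tauP i.
    rewrite zE rmorph_sum mulr_sumr; apply: eq_bigr => j _.
    rewrite rmorphM rmorphXn ty (tau_ratfield tc tx (fx j)) exprMn -rmorphXn.
    rewrite expr_div_n !rmorphM /= -!exprM [(j * i)%N]mulnC [(l * i)%N]mulnC.
    by ring.
  rewrite (bigD1 l) //= [X in _ + X]big1 ?addr0 => [|j jl].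
    under eq_bigr do rewrite divff ?expf_neq0 // expr1n rmorph1.
    by rewrite sumr_const card_ord rmorph_nat.
  rewrite -rmorph_sum; set r := zeta ^+ j / zeta ^+ l.
  have rn : r ^+ n = 1 by rewrite expr_div_n !zn divr1.
  have r1 : r - 1 != 0.
    rewrite subr_eq0; apply: contra jl => /eqP re.
    have : zeta ^+ j == zeta ^+ l by rewrite -(divfK (expf_neq0 l zeta0) (zeta ^+
      j)) -/r re mul1r.
    by rewrite (eq_prim_root_expr zetaP) !modn_small.
  suff -> : \sum_(i < n) r ^+ i = 0 by rewrite rmorph0 mul0r.
  by apply: (mulfI r1); rewrite -subrX1 rn subrr mulr0.
have nk : n%:R != 0 :> k by move/pcharf0P: char0 => ->; rewrite -lt0n.
have -> : f l * y ^+ l = iota n%:R^-1 * \sum_(i < n) iota ((zeta ^+ i) ^- l) * tau i z.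
  by rewrite sumE mulrA -rmorphM mulVf // rmorph1 mul1r.
apply/ord_geZ/ord_ge_sum => i _; apply: ord_geZ.
by have [_ _ _] := tauP i; apply.
Qed.

Lemma regular_monomial f j : (j < n)%N -> ratfield iota x f -> regular (f * y ^+ j) ->
  exists g, f * y ^+ j = evp iota u g * wfun j.
Proof.
move=> jn fx freg; have fu : ratfield iota u (f / u ^+ cdeg j).
  have [_ _ EV] := ratfield_sub iota u; apply: EV.
    exact: ratfield_trans ratfield_xu fx.
  have -> : u ^+ cdeg j = evp iota u 'X^(cdeg j) by rewrite rmorphXn /= evpX.
  exact: ratfield_evp.
have fE : f * y ^+ j = f / u ^+ cdeg j * wfun j.
  by rewrite /wfun mulrA divfK // expf_neq0.
rewrite fE in freg *; have [p [q [qn fuE]]] := fu; rewrite -!/(evp _ _ _) in qn fuE.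
rewrite {}fuE in freg *.
have q0 : q != 0 by apply: contraNneq qn => ->; rewrite rmorph0.
pose d := gcdp p q; have dn : d != 0 by rewrite gcdp_eq0 negb_and q0 orbT.
pose p1 := p %/ d; pose q1 := q %/ d.
have pE : p = p1 * d by rewrite divpK // dvdp_gcdl.
have qE : q = q1 * d by rewrite divpK // dvdp_gcdr.
have cop : coprimep p1 q1 by apply: coprimep_div_gcd; rewrite q0 orbT.
move: qn freg; rewrite pE qE !rmorphM mulf_eq0 negb_or => /andP[q1n dn'].
rewrite -mulf_div divff // mulr1 => freg.
have [sq1|sq1] := leqP (size q1) 1.
  have q1E : evp iota u q1 = iota q1`_0 by rewrite {1}(size1_polyC sq1) evpC.
  exists ((q1`_0)^-1 *: p1); rewrite evpZ fmorphV -q1E.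
  by congr (_ * _); rewrite mulrC.
(* A root c of the reduced denominator would give a pole at a zero of u - c: the numerator is a unit
   there, and [wfun j] vanishes to smaller order than u - c. *)
have /closed_rootP[c qc] : size q1 != 1%N by rewrite neq_ltn sq1 orbT.
have [Q Qc] := u_shift_zero c.
have QP : Q != Pa.
  apply: contraTneq Qc => ->; have [_ ->] := u_shift_neq0 c; rewrite -leNgt.
  by rewrite oppr_le0.
have Qu1 : ord_ge Q 1 (u - iota c) by right; ord_lia.
have p1c : p1.[c] != 0 by apply: coprimep_root qc; rewrite coprimep_sym.
have [p1n vp1] := ord_evp_at Qu1 p1c.
have /factor_theorem[q2 q2E] := qc.
have q1E : evp iota u q1 = evp iota u q2 * (u - iota c).
  by rewrite q2E rmorphM /= evpXsubC.
have vq1 : Q (u - iota c) <= Q (evp iota u q1).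
  have : evp iota u q1 != 0 by [].
  rewrite q1E mulf_eq0 negb_or => /andP[q2n un'].
  rewrite ordM // lerDr; apply: (ord_geE q2n); apply: ord_ge_evp.
  exact: ord_ge_u.
have q1n' : (evp iota u q1)^-1 != 0 by rewrite invr_eq0.
have pqn := mulf_neq0 p1n q1n'; have wn := wfun_neq0 j.
have := ord_geE (mulf_neq0 pqn wn) (freg Q QP).
rewrite (ordM Q pqn wn) (ordM Q p1n q1n') ordV vp1.
have := ord_wfun_lt jn QP Qc; move: vq1 => le1 lt le2; exfalso.
move: le1 lt le2; clear; move: (Q (evp iota u q1)) (Q (wfun j)) (Q (u - iota c)).
by move=> A B D; lia.
Qed.

Lemma regular_expand z : regular z ->
  exists g : 'I_n -> {poly k}, z = \sum_j evp iota u (g j) * wfun j.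
Proof.
move=> zreg; have [f fx zE] := spans_y z.
have freg := regular_coeff zreg fx zE.
have /choice[g gE] : forall j : 'I_n, exists g, f j * y ^+ j = evp iota u g * wfun j.
  by move=> j; apply: regular_monomial.
by exists g; rewrite zE; apply: eq_bigr.
Qed.

Lemma ord_Pa_term (j : 'I_n) g : g != 0 -> evp iota u g * wfun j != 0 /\
  Pa (evp iota u g * wfun j) = j%:Z - n%:Z * ((size g).-1 + cdeg j)%N%:Z.
Proof.
move=> gn; have Pu : Pa u < 0 by rewrite ord_Pa_u oppr_lt0 ltz_nat.
have [ugn vg] := ord_evp_pole un Pu gn.
rewrite mulf_neq0 ?wfun_neq0 //; split=> //.
rewrite ordM ?wfun_neq0 // vg ordM ?expf_neq0 // !ordXn // ord_Pa_u.
have [_ ->] := ord_over_root Pa_pos; rewrite PoszD; ring.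
Qed.

Lemma ord_Pa_term_inj (j l : 'I_n) (d e : nat) :
  j%:Z - n%:Z * d%:Z = l%:Z - n%:Z * e%:Z -> j = l /\ d = e.
Proof.
move=> eq; have : (j + n * e = l + n * d)%N by lia.
have := ltn_ord j; have := ltn_ord l; move=> ln jn e1.
have jl : j = l :> nat.
  have := congr1 (modn^~ n) e1; rewrite ![(n * _)%N]mulnC ![(_ + _ * n)%N]addnC.
  by rewrite !modnMDl !modn_small.
split; first exact/val_inj.
by apply/eqP; rewrite eq_sym -(eqn_pmul2l n0) -(eqn_add2l j) {2}jl e1.
Qed.

Definition pole_divisor N : {freeg (point C) / int} := << (N * n)%N%:Z *g Pa >>.

(** The pole of u^i w_j at [Pa] has order n (i + c_j) - j, which is at most N n exactly when i + c_j
    <= N, since j < n. Truncated subtraction leaves no i when c_j > N. *)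
Definition basis_index N := {j : 'I_n & 'I_(N.+1 - cdeg j)}.

Definition basis_fun N (p : basis_index N) : C := u ^+ tagged p * wfun (tag p).

Lemma pole_space_regular N f : riemann_roch_space (pole_divisor N) f <->
  regular f /\ ord_ge Pa (- (N * n)%N%:Z) f.
Proof.
rewrite riemann_roch_spaceP; split=> [fD|[freg fP] Q]; last first.
  rewrite coeffU; have [->|QP] := eqVneq Q Pa; first by rewrite mulr1.
  by rewrite mulr0 oppr0; apply: freg.
split=> [Q QP|]; last by have := fD Pa; rewrite coeffU eqxx mulr1.
by have := fD Q; rewrite coeffU eq_sym (negPf QP) mulr0 oppr0.
Qed.

Lemma basis_fun_ord N (p : basis_index N) : basis_fun p != 0 /\
  Pa (basis_fun p) = (tag p)%:Z - n%:Z * (tagged p + cdeg (tag p))%N%:Z.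
Proof.
have := @ord_Pa_term (tag p) 'X^(tagged p); rewrite -size_poly_eq0 size_polyXn.
by rewrite rmorphXn /= evpX; apply.
Qed.

Lemma pole_space_basis N :
  sub_dim (constants iota) (riemann_roch_space (pole_divisor N)) #|{: basis_index N}|.
Proof.
apply: (@sub_dim_basis _ _ _ (@basis_fun N)); last first.
  apply: (@free_ord_inj _ _ Pa) => [p|p q]; first by have [] := basis_fun_ord p.
  have [_ ->] := basis_fun_ord p; have [_ ->] := basis_fun_ord q.
  case: p q => [j i] [l i'] /= /ord_Pa_term_inj[jl]; subst l.
  by move/addIn/val_inj ->.
move=> z; rewrite pole_space_regular; split=> [[e ec ->]|[zreg zP]].
  have /choice[e' e'E] := ec.
  split=> [Q QP|].
    apply: ord_ge_sum => p _; rewrite e'E; apply: ord_geZ.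
    rewrite -[0]addr0; apply: ord_geM; first exact/ord_geX/ord_ge_u.
    by right; apply: ord_wfun_ge0.
  apply: ord_ge_sum => p _; rewrite e'E; apply: ord_geZ; right.
  have [_ ->] := basis_fun_ord p; case: p => j i /=.
  have := ltn_ord i; rewrite ltn_subRL addnC => le.
  have : (n * (i + cdeg j) <= N * n)%N by rewrite mulnC leq_mul2r -ltnS le orbT.
  lia.
have [g zE] := regular_expand zreg.
(* The terms have distinct orders at [Pa], so none of their poles cancel and each term obeys the
   bound on the sum. *)
have gsize j : (size (g j) <= N.+1 - cdeg j)%N.
  have [->|gn] := eqVneq (g j) 0; first by rewrite size_poly0.
  have [tn vt] := ord_Pa_term j gn.
  have [|//|zn zle] := @ord_sum_distinct _ _ Pa _ (fun j =>
    evp iota u (g j) * wfun j) _ j.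
    move=> i l; rewrite !mulf_eq0 !negb_or => /andP[gi _] /andP[gl _].
    have gin : g i != 0 by apply: contraNneq gi => ->; rewrite rmorph0.
    have gln : g l != 0 by apply: contraNneq gl => ->; rewrite rmorph0.
    have [_ ->] := ord_Pa_term i gin; have [_ ->] := ord_Pa_term l gln.
    by case/ord_Pa_term_inj.
  rewrite -zE in zn zle; have := ord_geE zn zP => le.
  have : - (N * n)%N%:Z <= j%:Z - n%:Z * ((size (g j)).-1 + cdeg j)%N%:Z.
    by rewrite -vt; apply: le_trans le zle.
  have sg : (0 < size (g j))%N by rewrite lt0n size_poly_eq0.
  move: sg; move: (size (g j)) (cdeg j) (ltn_ord j) => s c jn s0 le'.
  have {le'} : (n * (s.-1 + c) <= N * n + j)%N by lia.
  move=> le'; have : (n * (s.-1 + c) < n * N.+1)%N by rewrite mulnS (leq_ltn_trans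
    le') // mulnC addnC ltn_add2r.
  by rewrite ltn_pmul2l //; lia.
exists (fun p : basis_index N => iota (g (tag p))`_(tagged p)).
  by move=> p; eexists.
rewrite zE; transitivity (\sum_(j < n) \sum_(i < N.+1 - cdeg j)
    iota (g j)`_i * (u ^+ i * wfun j)); last by rewrite sig_big_dep.
apply: eq_bigr => j _; rewrite /evp (@horner_coef_wide _ (N.+1 - cdeg j)).
  by rewrite mulr_suml; apply: eq_bigr => i _; rewrite coef_map [RHS]mulrA.
by rewrite size_map_poly.
Qed.

Lemma deg_h_gt0 : (0 < m)%N.
Proof.
have hn : h != 0 by exact: separable_poly_neq0.
by rewrite /m -ltnS prednK ?(root_size_gt1 hn ha) // lt0n size_poly_eq0.
Qed.

Lemma card_basis_index N :
  #|{: basis_index N}| = (\sum_(j < n) (N.+1 - cdeg j))%N.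
Proof.
rewrite card_tagged sumnE big_map big_enum /=.
by apply: eq_bigr => i _; rewrite card_ord.
Qed.

(** Truncation can only enlarge the count, hence an inequality for every N. It becomes an equality
    once N >= m, because then c_j <= m <= N. *)
Lemma card_basis_index_ge N :
  (n * N.+1 <= #|{: basis_index N}| + \sum_(j < n) cdeg j)%N.
Proof.
rewrite card_basis_index -big_split /= -[n in leqLHS]card_ord -sum_nat_const.
by apply: leq_sum => j _; rewrite addnC -leq_subLR.
Qed.

Lemma card_basis_index_eq N : (m <= N)%N ->
  (n * N.+1 = #|{: basis_index N}| + \sum_(j < n) cdeg j)%N.
Proof.
move=> mN; rewrite card_basis_index -big_split /= -[n in LHS]card_ord -sum_nat_const.
apply: eq_bigr => j _; rewrite subnK // (leq_trans _ (leqW mN)) //.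
have /andP[_ lt] := cdegP j; rewrite -ltnS -(ltn_pmul2l n0); apply: leq_trans lt _.
by rewrite mulnS addnC leq_add2l leq_mul2r ltnW ?orbT.
Qed.

Let L D := riemann_roch_space (C := C) D.

(* A product of [r] factors [u - c] has its only pole at [Pa], of order [n r]. *)
Lemma zero_cover (s : seq (point C)) : exists (M r : nat) (f : C) (s' : seq (point C)),
  [/\ f != 0, Pa f = - (n * r)%N%:Z,
      forall Q, Q != Pa -> Q f <= (count_mem Q s')%:Z,
      (n * M <= count_mem Pa s')%N /\ (forall Q, (count_mem Q s <= count_mem Q s')%N) &
      (size s' <= n * (M + r))%N].
Proof.
elim: s => [|P s [M [r [f [s' [fn fPa fQ [cPa cQ] ss']]]]]].
  exists 0%N, 0%N, 1, [::]; rewrite oner_neq0 !muln0; split=> //.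
    by rewrite ord_one.
  by move=> Q _; rewrite ord_one.
(* A new point equal to [Pa] is covered by n further copies of [Pa], counted by M. Any other P is
   covered by the zeros of u - c, where c is the residue of u at P; they number at most n, and r
   counts these factors. *)
have [->|PP] := eqVneq P Pa.
  exists M.+1, r, f, (nseq n Pa ++ s'); split=> //.
  - move=> Q QP; rewrite count_cat count_nseq /= eq_sym (negPf QP) mul0n add0n.
    exact: fQ.
  - split=> [|Q]; first by rewrite count_cat count_nseq /= eqxx mul1n mulnS leq_add2l.
    rewrite count_cat count_nseq /=; apply: leq_add (cQ Q).
    by case: (Pa == Q); rewrite ?mul1n.
  - by rewrite size_cat size_nseq addSn mulnS leq_add2l.
have [c /(ord_geE (proj1 (u_shift_neq0 _))) Pc] := model_residue (ord_ge_u PP).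
have [uc vuc] := u_shift_neq0 c.
have [z zsize zQ] := zero_divisor uc (spans_shift c).
rewrite card_ord in zsize.
exists M, r.+1, (f * (u - iota c)), (z ++ s'); split.
- by rewrite mulf_neq0.
- by rewrite ordM // fPa vuc; lia.
- move=> Q QP; rewrite ordM // count_cat PoszD addrC lerD ?fQ //.
  by rewrite zQ le_max lexx orbT.
- split=> [|Q]; first by rewrite count_cat; apply: leq_trans cPa (leq_addl _ _).
  rewrite count_cat /=; apply: leq_add (cQ Q); have [<-|//] := eqVneq P Q.
  by rewrite -lez_nat zQ le_max Pc orbT.
by rewrite size_cat addnS mulnS leq_add.
Qed.

(** Division by f embeds L((M + r) n Pa) into L(s'), whose divisor dominates D and has degree at
    most n (M + r). Going down from s' to D loses at most one dimension per point. *)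
Lemma riemann_inequality D l : sub_dim (constants iota) (L D) l ->
  deg D - l%:Z + 1 <= (model_genus n m)%:Z.
Proof.
move=> dimD; have [s sD] := abs_list D.
have [M [r [f [s' [fn fPa fQ [cPa cQ] ss']]]]] := zero_cover s.
have dimN := sub_dim_ge (pole_space_basis (M + r)) (sub0 (constants_sub iota))
  (let: And3 e _ _ := constants_sub iota in e).
have dims' : dim_ge (constants iota) (L (list_divisor s')) #|{: basis_index (M + r)}|.
  apply: (dim_ge_scale (c := f^-1) _ _ dimN); first by rewrite invr_eq0.
  move=> z /pole_space_regular[zreg zP]; apply/riemann_roch_spaceP => Q.
  rewrite coeff_list_divisor; have [->|QP] := eqVneq Q Pa.
    have : ord_ge Pa (- ((M + r) * n)%N%:Z + (n * r)%N%:Z) (z / f).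
      by apply: ord_geM => //; right; rewrite ordV fPa opprK.
    by apply: ord_geW; lia.
  have : ord_ge Q (0 - (count_mem Q s')%:Z) (z / f).
    apply: ord_geM; first exact: zreg.
    by right; rewrite ordV lerN2 fQ.
  by rewrite sub0r.
have [|t dimt let'] := @riemann_roch_drop _ _ model_residue D _ _ _ dims'.
  move=> Q; rewrite coeff_list_divisor; apply: le_trans (ler_norm _) _.
  by rewrite -sD lez_nat cQ.
have := dim_ge_le dimt (sub_dim_le (constants_sub iota) dimD).
move: let'; rewrite degB deg_list_divisor /model_genus.
have := card_basis_index_ge (M + r); have := sum_ceil_mul_ge n0 deg_h_gt0.
move: ss'; rewrite mulnS; move: (deg D) (size s') (n * (M + r))%N.
move: (\sum_(j < n) cdeg j)%N #|{: basis_index (M + r)}|; clear; lia.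
Qed.

Lemma model_has_genus : has_genus C (model_genus n m).
Proof.
split; first exact: riemann_inequality.
exists (pole_divisor m), #|{: basis_index m}|; split; first exact: pole_space_basis.
rewrite degU /model_genus; have := card_basis_index_eq (leqnn m).
have := sum_ceil_mul_ge n0 deg_h_gt0; rewrite mulnS mulnC.
move: (\sum_(j < n) cdeg j)%N #|{: basis_index m}| (n * m)%N; clear; lia.
Qed.

End Genus.

Lemma has_genus_unique (k : closedFieldType) (C : curve k) g g' :
  has_genus C g -> has_genus C g' -> g = g'.
Proof.
move=> [le [D [l [dimD e]]]] [le' [D' [l' [dimD' e']]]].
have := le _ _ dimD'; have := le' _ _ dimD; rewrite e e'; lia.
Qed.

Lemma transc_of_zero (k : closedFieldType) (C : curve k) (Q : point C) f :
  0 < Q f -> ~ algebraicOver (cst C) f.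
Proof.
move=> Qf [p pn /eqP pf]; have fn : f != 0.
  by apply: contraTneq Qf => ->; rewrite Defs.ord0.
by have [] := ord_evp fn Qf pn; rewrite /evp pf eqxx.
Qed.

Lemma point_above (k : closedFieldType) (C : curve k) (x : C) (I : finType)
    (b : I -> C) a : ~ algebraicOver (cst C) x ->
  (forall z, spans (ratfield (cst C) x) b z) ->
  exists P : point C, 0 < P (x - cst C a).
Proof.
move=> xtr bx; apply: (zero_exists (transc_shift xtr) (b := b)) => z.
exact: spans_ratfield (ratfield_shift x a) (bx z).
Qed.

(** * Curves of small degree in [x] *)

Section Model.
Variables (k : closedFieldType) (C : curve k) (n : nat) (h : {poly k}) (x y : C).
Notation iota := (cst C).
Hypothesis n0 : (0 < n)%N.
Hypothesis model : affine_model n h x y.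

Let x_transc := model_transc n0 model.
Let spans_y := model_spans n0 model.

(** If h were constant, y would be a constant d, and Y - d would be a multiple of Y^n - h, which has
    degree n > 1. *)
Lemma model_nonconstant : (1 < n)%N -> h != 0 -> (1 < size h)%N.
Proof.
move=> n1 hn; rewrite ltnNge; apply/negP => sh.
pose c := h`_0; have hE : h = c%:P by exact: size1_polyC.
have [r rE] := closed_field_poly_normal ('X^n - c%:P : {poly k}).
have : evp iota y ('X^n - c%:P) = 0.
  by rewrite rmorphB rmorphXn /= evpX evpC (model_eq model) hE evpC subrr.
rewrite rE evp_prod lead_coefXnsubC // rmorph1 mul1r => /eqP;
  rewrite prodf_seq_eq0 => /hasP[d _ /= yd].
have [/(_ ('X - d%:P%:P))[ker _] _] := model.
have /ker[Q] : eval_xy x y ('X - d%:P%:P) = 0.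
  by rewrite eval_xyE map_polyXsubC hornerXsubC /= evpC; apply/eqP.
have [->|Qn] := eqVneq Q 0; first by rewrite mul0r => /eqP; rewrite polyXsubC_eq0.
move/(congr1 (fun p : {poly {poly k}} => size p)); rewrite size_XsubC.
rewrite size_mul // -?size_poly_eq0 size_XnsubC // addnS /=.
have : (0 < size Q)%N by rewrite lt0n size_poly_eq0.
by move: (size Q) n1 => s; clear; lia.
Qed.

Hypothesis sep_h : separable_poly h.

Let xan c : x - iota c != 0 := xsub_neq0 x_transc c.

(** x is a root of h(X) - y^n over k(y), and [eval_xy] already presents an element as a polynomial
    in x with coefficients in k[y]. *)
Lemma model_spans_x z : (1 < size h)%N ->
  spans (ratfield iota y) (fun j : 'I_(size h).-1 => x ^+ j) z.
Proof.
move=> sh; have hn : h != 0 by exact: separable_poly_neq0.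
have lcn : iota (lead_coef h) != 0 by rewrite fmorph_eq0 lead_coef_eq0.
have sy := ratfield_sub iota y; have [_ EB _] := sy.
have Eyn i : ratfield iota y (y ^+ i) by rewrite -(evpX iota y) -rmorphXn evpX;
  apply: ratfield_evp.
pose mu : {poly C} := map_poly iota h - (y ^+ n)%:P.
have smu : size mu = size h.
  by rewrite /mu size_polyDl size_map_poly // size_polyN (leq_ltn_trans
    (size_polyC_leq1 _)).
have lmu : lead_coef mu = iota (lead_coef h).
  by rewrite lead_coefDl ?lead_coef_map // size_map_poly size_polyN (leq_ltn_trans
    (size_polyC_leq1 _)).
have coefP (P : {poly {poly k}}) i :
    ratfield iota y ((map_poly (map_poly iota) P).[y%:P])`_i.
  rewrite horner_coef coef_sum; apply: (sub_sum sy) => j.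
  rewrite -rmorphXn coefMC coef_map coef_map; apply: (subM sy) => //.
  exact: ratfield_cst.
have [_ /(_ z)[P [Q [Qn ->]]]] := model; rewrite /eval_xy in Qn *.
apply: (@span_powers _ _ sy _ ((lead_coef mu)^-1 *: mu)) => //.
- move=> i; rewrite coefZ lmu -fmorphV; apply: (subM sy); first exact: ratfield_cst.
  rewrite coefB coef_map coefC; apply: EB; first exact: ratfield_cst.
  by case: ifP => // _; exact: sub0.
- by rewrite monicE lead_coefZ lmu mulVf.
- by rewrite size_scale ?smu ?prednK ?invr_eq0 ?lmu // ltnW.
- rewrite rootZ ?invr_eq0 ?lmu // /root /mu hornerD hornerN hornerC.
  by rewrite -/(evp _ _ _) (model_eq model) subrr.
Qed.

Lemma point_above_inj (P : point C) a b :
  0 < P (x - iota a) -> 0 < P (x - iota b) -> a = b.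
Proof.
move=> Pa Pb; apply/eqP; apply: contraT; rewrite -subr_eq0 => abn.
have : ord_ge P 1 (iota (a - b)).
  have -> : iota (a - b) = (x - iota b) - (x - iota a) by rewrite rmorphB; ring.
  by apply: ord_geB; right; ord_lia.
by move/ord_geE; rewrite fmorph_eq0 ord_cst // => /(_ abn).
Qed.

(** y vanishes at a point over each root of h. By separability these are deg h distinct points, and
    the number of zeros bounds the degree from below. *)
Lemma degree_over_y (I : finType) (b : I -> C) :
  (forall z, spans (ratfield iota y) b z) -> ((size h).-1 <= #|I|)%N.
Proof.
move=> by_; have hn : h != 0 by exact: separable_poly_neq0.
have yn : y != 0 := y_neq0 n0 sep_h (model_eq model) x_transc.
have /choice[f fP] : forall a, exists P : point C, 0 < P (x - iota a).
  by move=> a; apply: point_above x_transc spans_y.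
have [r rE] := closed_field_poly_normal h.
have lcn : lead_coef h != 0 by rewrite lead_coef_eq0.
have ur : uniq r.
  by rewrite -separable_prod_XsubC -(eqp_separable (eqp_scale _ lcn)) -rE.
have finj : injective f.
  by move=> a c ac; apply: (point_above_inj (fP a)); rewrite ac.
have fy P : P \in map f r -> 0 < P y.
  case/mapP => a ar ->; have ha : root h a by rewrite rE rootZ // root_prod_XsubC.
  have := ord_y_root n0 sep_h (model_eq model) x_transc ha (fP a).
  by have := fP a; move=> + e; rewrite -e pmulr_rgt0 ?ltz_nat.
have ufr : uniq (map f r) by rewrite (map_inj_uniq finj).
apply: leq_trans (zeros_le_degree yn by_ ufr fy).
rewrite {1}rE size_scale // size_prod_XsubC /= -(size_map f) -sum1_size.
rewrite big_seq [leqRHS]big_seq; apply: leq_sum => P /fy; ord_lia.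
Qed.

Lemma hyperelliptic_of_quadratic g :
  size h = 3 -> (2 <= g)%N -> has_genus C g -> hyperelliptic C.
Proof.
move=> sh g2 gC; split; first by exists g.
have sy := ratfield_sub iota y.
have yn : y != 0 := y_neq0 n0 sep_h (model_eq model) x_transc.
have [a ha] : exists a, root h a by apply/closed_rootP; rewrite sh.
have [P Pa] := point_above a x_transc spans_y.
have Py : 0 < P y.
  have := ord_y_root n0 sep_h (model_eq model) x_transc ha Pa.
  by move=> e; move: Pa; rewrite -e pmulr_rgt0 ?ltz_nat.
have sp z : spans (ratfield iota y) (fun j : 'I_2 => x ^+ j) z.
  by have := model_spans_x z; rewrite sh; apply.
(* If x were in k(y), then F = k(y) would be spanned by 1 alone, against [degree_over_y] with deg h
   = 2. *)
have xE : ~ ratfield iota y x.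
  move=> xE; have := @degree_over_y 'I_1 (fun=> 1); rewrite sh card_ord => H.
  suff : (2 <= 1)%N by []; apply: H => z; exists (fun=> z);
    last by rewrite big_ord1 mulr1.
  move=> _; have [e Ee ->] := sp z; apply: (sub_sum sy) => j; apply: (subM sy) => //.
  by case: j => -[|[|//]] lt; rewrite ?expr0 ?expr1 //; case: sy.
exists y; first exact: transc_of_zero Py.
exists (fun j : 'I_2 => x ^+ j); split.
  by move=> z; split=> // _; have [e] := sp z; exists e.
move=> c Ec; rewrite big_ord_recl big_ord1 /= mulr1 expr1 => c0.
have c1 : c (lift ord0 ord0) = 0.
  apply: contrapT => /eqP cn; apply: xE.
  have -> : x = - c ord0 / c (lift ord0 ord0).
    apply: (mulIf cn); rewrite divfK //; apply/eqP.
    by rewrite -addr_eq0 mulrC addrC; apply/eqP.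
  by case: (sy) => _ _; apply=> //; apply: subN.
move: c0; rewrite c1 mul0r addr0 => c0 i.
by case: i => -[|[|//]] lt; [rewrite -[RHS]c0|rewrite -[RHS]c1]; congr (c _);
  apply: val_inj.
Qed.

End Model.

(** * A cubic model with a function of degree 2 *)

Section NotHyperelliptic.
Variables (k : closedFieldType) (char0 : [pchar k] =i pred0).
Variables (C : curve k) (n : nat) (h : {poly k}) (x y : C).
Notation iota := (cst C).
Hypothesis n0 : (0 < n)%N.
Hypothesis model : affine_model n h x y.
Hypothesis sep_h : separable_poly h.
Hypothesis size_h : size h = 4.

Let x_transc := model_transc n0 model.
Let spans_y := model_spans n0 model.
Let yn : y != 0 := y_neq0 n0 sep_h (model_eq model) x_transc.

Let spans_x z : spans (ratfield iota y) (fun j : 'I_3 => x ^+ j) z.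
Proof. by have := model_spans_x model sep_h z; rewrite size_h; apply. Qed.

Variables (t : C) (b : 'I_2 -> C).
Hypothesis b_basis : sub_basis (ratfield iota t) (fun=> True) b.

(* Otherwise 3 = [F : k(y)] would be a multiple of 2 = [F : k(t)]. *)
Lemma y_notin_ratfield : ~ ratfield iota t y.
Proof.
have [bsp bfree] := b_basis; have bt z : spans (ratfield iota t) b z.
  by have [/(_ I)[c ? ?] _] := bsp z; exists c.
have sy := ratfield_sub iota y; have st := ratfield_sub iota t; move=> yt.
have [ty|ty] := pselect (ratfield iota y t).
  have := degree_over_y n0 model sep_h (b := b).
  rewrite size_h card_ord => H; suff : (3 <= 2)%N by [].
  by apply: H => z; apply: spans_ratfield ty (bt z).
(* As t is not in k(y), 1 and t are independent over k(y); their products with [b] are 4 independent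
   elements in a space of dimension at most 3. *)
pose c (p : bool * 'I_2) := t ^+ p.1 * b p.2.
have cfree : free_over (ratfield iota y) c.
  move=> e Ee; have -> : \sum_p e p * c p = \sum_i \sum_j e (i, j) * c (i, j).
    by rewrite pair_bigA; apply: eq_bigr => -[].
  rewrite exchange_big /=.
  under eq_bigr do rewrite big_bool /c /= expr0 expr1 mul1r mulrA -mulrDl.
  have Et p : ratfield iota t (e p) by exact: ratfield_trans yt (Ee p).
  move/bfree => e0; have {}e0 j : e (true, j) * t + e (false, j) = 0.
    by apply: e0 => i; apply: (subD st) => //; apply: (subM st) => //; exact: ratfield_id.
  have e1 j : e (true, j) = 0.
    apply: contrapT => /eqP en; apply: ty.
    have -> : t = - e (false, j) / e (true, j).
      by apply: (mulIf en); rewrite divfK //; apply/eqP; rewrite -addr_eq0 mulrC;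
        apply/eqP.
    by case: (sy) => _ _; apply=> //; apply: subN.
  by case=> -[] j; [exact: e1|have := e0 j; rewrite e1 mul0r add0r].
have := dim_ge_card (V := fun=> True) (fun=> I) cfree.
rewrite card_prod card_bool card_ord =>
  /dim_ge_le/(_ (dim_le_span sy (V := fun=> True) (fun z _ => spans_x z))).
by rewrite card_ord.
Qed.

(* Castelnuovo's argument: {1, 1/y} is independent over k(t), so that the
   divisor r (t)_oo + (y)_0, of degree at most 2r + 3, has a space of sections
   of dimension at least 2r + 2; hence the genus is at most 2. *)
Lemma genus_le2 : ~ algebraicOver iota t -> (model_genus n 3 <= 2)%N.
Proof.
move=> t_transc; have [bsp bfree] := b_basis; have bt z : spans (ratfield iota t) b z.
  by have [/(_ I)[c ? ?] _] := bsp z; exists c.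
have [a ha] : exists a, root h a by apply/closed_rootP; rewrite size_h.
have [Pa Pa_pos] := point_above a x_transc spans_y.
have tn c : t - iota c != 0.
  by rewrite -evpXsubC; apply: transc_evp t_transc _ _; rewrite polyXsubC_eq0.
(* 1/t or t - c replaces t: it generates the same field and vanishes at [Pa], so that r times its
   zeros dominates N n Pa. *)
have [w [tw wt Pw wn]] : exists w, [/\ ratfield iota t w, ratfield iota w t, 0 < Pa
  w & w != 0].
  have st := ratfield_sub iota t; have [E1 EB EV] := st.
  have [Pt|Pt] := ltP (Pa t) 0.
    exists t^-1; rewrite ordV oppr_gt0 invr_eq0; split=> //.
    - by rewrite -div1r; apply: EV => //; exact: ratfield_id.
    - have [E1' _ EV'] := ratfield_sub iota t^-1.
      by have := EV' _ _ E1' (ratfield_id iota t^-1); rewrite div1r invrK.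
    - by have := tn 0; rewrite rmorph0 subr0.
  have [c /(ord_geE (tn c)) Pc] := model_residue n0 model (ord_ge_le Pt).
  exists (t - iota c); split=> //.
  - by apply: EB; [exact: ratfield_id|exact: ratfield_cst].
  - exact: ratfield_shift.
have y_w : ~ ratfield iota w y.
  by move=> yw; apply: y_notin_ratfield; apply: ratfield_trans tw yw.
have bw z : spans (ratfield iota w) b z by exact: spans_ratfield wt (bt z).
have [zw sw zwP] := zero_divisor wn bw; have [zy sy zyP] := zero_divisor yn spans_x.
rewrite !card_ord in sw sy.
have w_transc := transc_of_zero Pw.
(* N = deg h is the least value for which [card_basis_index_eq] gives the exact dimension of L(N n
   Pa). *)
pose N := 3%N; pose r := (N * n)%N.
pose D := list_divisor (flatten (nseq r zw) ++ zy).
have countD Q : coeff Q D = r%:Z * (count_mem Q zw)%:Z + (count_mem Q zy)%:Z.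
  by rewrite coeff_list_divisor count_cat count_flatten map_nseq sumn_nseq PoszD
    mulnC PoszM.
pose f (p : bool * 'I_r.+1) : C := w ^- p.2 * y ^- p.1.
have fn p : f p != 0 by rewrite mulf_neq0 // invr_eq0 expf_neq0.
have fD p : riemann_roch_space D (f p).
  right=> Q; rewrite countD zwP zyP ordM ?invr_eq0 ?expf_neq0 // !ordV !ordXn //.
  have := ltn_ord p.2; move: (nat_of_ord p.2) (Q w) (Q y) => i e e' ir.
  have ie : e * i%:Z <= r%:Z * Num.max 0 e.
    rewrite /Num.max; case: ifP => e0; nia.
  have je : e' * p.1%:Z <= Num.max 0 e'.
    rewrite /Num.max; case: ifP; case: (p.1); lia.
  lia.
have ffree : free_over (constants iota) f.
  move=> e /choice[c ec].
  have -> : \sum_p e p * f p = \sum_i \sum_j e (i, j) * f (i, j).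
    by rewrite pair_bigA; apply: eq_bigr => -[].
  rewrite big_bool /=.
  pose p s := \poly_(i < r.+1) c (s, inord i).
  have Ap s : \sum_(j < r.+1) e (s, j) * w ^- j = evp iota w^-1 (p s).
    rewrite /evp (@horner_coef_wide _ r.+1) ?size_map_poly ?size_poly //.
    by apply: eq_bigr => j _; rewrite coef_map coef_poly ltn_ord inord_val exprVn ec.
  under eq_bigr do rewrite /f /= expr1 mulrA.
  under [X in _ + X]eq_bigr do rewrite /f /= expr0 invr1 mulr1.
  rewrite -mulr_suml !Ap => A0.
  have wV_transc : ~ algebraicOver iota w^-1.
    by apply: (@transc_of_pole _ _ Pa); rewrite ordV oppr_lt0.
  have sw' := ratfield_sub iota w; have [E1 _ EV] := sw'.
  have wVE : ratfield iota w w^-1.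
    by rewrite -div1r; apply: EV => //; exact: ratfield_id.
  have AE s : ratfield iota w (evp iota w^-1 (p s)).
    exact: ratfield_trans wVE (ratfield_evp _ _ _).
  (* Otherwise the relation could be solved for y, placing y in k(w). *)
  have At : evp iota w^-1 (p true) = 0.
    apply: contrapT => /eqP An; apply: y_w.
    have -> : y = - evp iota w^-1 (p true) / evp iota w^-1 (p false).
      have fn0 : evp iota w^-1 (p false) != 0.
        apply: contra_eq_neq A0 => ->; rewrite addr0 mulf_neq0 // invr_eq0 //.
      apply: (mulIf fn0); rewrite divfK //; apply: (mulIf (_ : y^-1 != 0)).
        by rewrite invr_eq0.
      rewrite mulrAC divff // mul1r; apply/eqP; rewrite mulNr -addr_eq0 addrC.
      exact/eqP.
    by apply: EV => //; apply: subN.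
  have Af : evp iota w^-1 (p false) = 0 by move: A0; rewrite At mul0r add0r.
  have p0 s : p s = 0.
    apply/eqP; apply: contraT => /(transc_evp wV_transc)/eqP; case.
    by case: s.
  move=> [s j]; rewrite ec; have /(congr1 (fun q : {poly k} => q`_j)) := p0 s.
  by rewrite coef_poly ltn_ord inord_val coef0 => ->; rewrite rmorph0.
have dimD := dim_ge_card fD ffree; rewrite card_prod card_bool card_ord in dimD.
have [|s dims les] := riemann_roch_drop (model_residue n0 model) (D :=
  pole_divisor n Pa N) _ dimD.
  move=> Q; rewrite countD coeffU; have [<-|_] := eqVneq Pa Q; last first.
    by rewrite mulr0 addr_ge0 // mulr_ge0.
  rewrite mulr1 zwP; have : 1 <= Num.max 0 (Pa w).
    by rewrite le_max orbC; move: Pw; ord_lia.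
  by move: (Num.max _ _) (count_mem Pa zy) => e c e1; rewrite -/r; nia.
(* Descending from D to N n Pa, of degree r, leaves dimension at least 2r + 2 - (2r + 3 - r) = r -
   1, while the exact dimension is r + 1 minus the genus. *)
have := dim_ge_le dims (sub_dim_le (constants_sub iota) (pole_space_basis char0 n0
  model sep_h ha Pa_pos N)).
have hN : ((size h).-1 <= N)%N by rewrite size_h.
have := card_basis_index_eq n0 hN.
move: #|{: basis_index n h N}| => a0; rewrite size_h /model_genus; move: les.
rewrite degB degU deg_list_divisor size_cat size_flatten /shape map_nseq sumn_nseq.
rewrite -/r /=; move: sw sy.
move: (size zw) (size zy) (\sum_(j < n) _)%N => a1 a2 a3.
rewrite /r /N; clear; nia.
Qed.

End NotHyperelliptic.

Lemma irreducible_factor (F : fieldType) (p : {poly F}) : (1 < size p)%N ->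
  exists2 q, irreducible_poly q & q %| p.
Proof.
have [s] := ubnP (size p); elim: s p => // s IHs p ltp p1.
have [irr|] := pselect (irreducible_poly p); first by exists p.
move/not_andP => -[//|/existsNP[q /not_implyP[q1 /not_implyP[qp nqp]]]].
have p0 : p != 0 by rewrite -size_poly_gt0 ltnW.
have q0 : q != 0 by apply: contraNneq p0 => q0; rewrite -dvd0p -q0.
have qlt : (size q < size p)%N.
  rewrite ltn_neqAle dvdp_leq // andbT; apply/negP => e; apply: nqp.
  by rewrite -dvdp_size_eqp.
have [||r irr rq] := IHs q; first exact: leq_trans qlt _.
  by rewrite ltn_neqAle eq_sym q1 size_poly_gt0.
by exists r => //; apply: dvdp_trans rq qp.
Qed.

Lemma fraction_eq (R : idomainType) (c : {fraction R}) :
  exists p q : R, q != 0 /\ c = FracField.tofrac p / FracField.tofrac q.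
Proof.
elim/quotW: c => r; exists (frac r).1, (frac r).2; split; first exact: denom_ratioP.
have dn : FracField.tofrac (frac r).2 != 0 by rewrite tofrac_eq0 denom_ratioP.
apply: (mulIf dn); rewrite divfK //.
rewrite /FracField.tofrac; unlock.
apply: (etrans (esym (FracField.pi_mul r (Ratio (frac r).2 1)))).
apply/eqmodP; rewrite /= FracField.equivfE /FracField.mulf.
rewrite !numden_Ratio ?mulf_neq0 ?oner_neq0 ?denom_ratioP //.
by rewrite !mulr1 mulrC.
Qed.

(** * Existence of superelliptic curves *)

Section Existence.
Variables (k : closedFieldType) (n : nat) (h : {poly k}).
Hypothesis n0 : (0 < n)%N.
Hypothesis sep_h : separable_poly h.
Hypothesis size_h : (1 < size h)%N.

Local Notation K0 := {fraction {poly k}}.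
Local Notation tofrac := (@FracField.tofrac {poly k}).
Variables (L : fieldExtType K0) (y : L).
Hypothesis yE : y ^+ n = in_alg L (tofrac h).
Hypothesis y_gen : <<1; y>>%VS = fullv.

Let emb : {rmorphism {poly k} -> L} := in_alg L \o tofrac.
Let iota : {rmorphism k -> L} := emb \o polyC.
Let x := emb 'X.

Let emb_inj p : emb p = 0 -> p = 0.
Proof.
move=> p0; apply/eqP; rewrite -(tofrac_eq0 p) -(fmorph_eq0 (in_alg L)).
exact/eqP.
Qed.

Let evp_emb p : evp iota x p = emb p.
Proof.
rewrite evpE -[in RHS](coefK p) poly_def rmorph_sum; apply: eq_bigr => i _.
by rewrite -mul_polyC rmorphM rmorphXn.
Qed.

Let x_transc : ~ algebraicOver iota x.
Proof.
case=> p pn /eqP px; have := evp_emb p; rewrite /evp px => /esym/emb_inj p0.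
by rewrite p0 eqxx in pn.
Qed.

Let ratfieldP z : ratfield iota x z <-> exists c, z = in_alg L c.
Proof.
split=> [[p [q [qn ->]]]|[c ->]].
  by rewrite -!/(evp _ _ _) !evp_emb -fmorph_div; eexists.
have [p [q [qn ->]]] := fraction_eq c; exists p, q; rewrite -!/(evp _ _ _) !evp_emb.
by split; [apply: contraNneq qn => /emb_inj ->|rewrite fmorph_div].
Qed.

Lemma extension_degree : ext_degree iota x (\dim {:L}).
Proof.
pose B := vbasis {:L}; exists (fun i => B`_i); split.
  move=> z; split=> // _; exists (fun i => in_alg L (coord B i z)).
    by move=> i; apply/ratfieldP; eexists.
  rewrite {1}(coord_vbasis (memvf z)); apply: eq_bigr => i _.
  by rewrite mulr_algl.
move=> c /= cE; have /choice[d dE] : forall i, exists d, c i = in_alg L d.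
  by move=> i; apply/ratfieldP.
under eq_bigr do rewrite dE mulr_algl.
move=> s0 i; rewrite dE; have /freeP/(_ _ s0)-> := basis_free (vbasisP {:L}).
by rewrite rmorph0.
Qed.

Definition extension_curve : curve k :=
  @Curve k L iota (ex_intro _ x (conj x_transc (ex_intro _ _ extension_degree))).

(* The irreducibility of [Y^n - h] comes for free: the powers of [y] are
   independent over k(x) because their values at a point over a root of [h]
   are distinct modulo those of k(x). *)
Lemma extension_model : @affine_model k extension_curve n h x y.
Proof.
have evE P : @eval_xy k extension_curve x y P = (map_poly emb P).[y].
  rewrite eval_xyE; congr (_.[y]); apply: eq_map_poly => p; exact: evp_emb.
have yxE : y ^+ n = @evp k extension_curve iota x h by rewrite yE evp_emb.
have [b [bsp _]] := extension_degree.
have sp z : @spans extension_curve (ratfield iota x) _ b z.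
  by have [/(_ I)[c]] := bsp z; exists c.
have [a ha] : exists a, root h a by apply/closed_rootP; rewrite neq_ltn size_h orbT.
have [P Pa] := @point_above k extension_curve x _ b a x_transc sp.
have monD : 'X^n - h%:P \is monic by exact: monicXnsubC.
split=> [Q|z]; last first.
  have : z \in <<1; y>>%VS by rewrite y_gen memvf.
  case/Fadjoin1_polyP => p ->.
  (* The quotients are closed under sum and product and contain k(x) and y, hence every polynomial
     in y over k(x). *)
  pose V w := exists P Q, @eval_xy k extension_curve x y Q != 0 /\
    w = @eval_xy k extension_curve x y P / @eval_xy k extension_curve x y Q.
  have VD w w' : V w -> V w' -> V (w + w').
    move=> [P1 [Q1 [n1 ->]]] [P2 [Q2 [n2 ->]]]; exists (P1 * Q2 + P2 * Q1), (Q1 * Q2).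
    rewrite !evE in n1 n2 *; rewrite !rmorphD !rmorphM hornerD !hornerM mulf_neq0 //.
    by split=> //; rewrite addf_div.
  have VM w w' : V w -> V w' -> V (w * w').
    move=> [P1 [Q1 [n1 ->]]] [P2 [Q2 [n2 ->]]]; exists (P1 * P2), (Q1 * Q2).
    rewrite !evE in n1 n2 *; rewrite !rmorphM !hornerM mulf_neq0 //.
    by split=> //; rewrite mulf_div.
  have Vpol P1 : V (@eval_xy k extension_curve x y P1).
    by exists P1, 1; rewrite !evE rmorph1 hornerC divr1; split=> //; exact: oner_neq0.
  have VC c : V (in_alg L c).
    have [p1 [q1 [q1n ->]]] := fraction_eq c; exists p1%:P, q1%:P.
    rewrite !evE !map_polyC !hornerC; split; last by rewrite fmorph_div.
    by apply: contraNneq q1n => /emb_inj ->.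
  have Vy : V y by have := Vpol 'X; rewrite evE map_polyX hornerX.
  change (V (map_poly (in_alg L) p).[y]).
  elim/poly_ind: p => [|p c IHp].
    by rewrite rmorph0 horner0 -(rmorph0 (in_alg L)); exact: VC.
  rewrite rmorphD rmorphM /= map_polyX map_polyC !hornerE.
  by apply: VD; [apply: VM|apply: VC].
split=> [Q0|[R ->]]; last first.
  rewrite evE rmorphM hornerM rmorphB /= map_polyXn map_polyC !hornerE.
  by rewrite yE subrr mulr0.
(* The coefficients lie in k[X], not in a field, but the divisor is monic. The remainder has degree
   less than n in Y and vanishes at y, so [powers_free] kills it. *)
have QE := Pdiv.RingMonic.rdivp_eq monD Q; set R := Pdiv.Ring.rmodp _ _ in QE.
exists (Pdiv.Ring.rdivp Q ('X^n - h%:P)); rewrite {1}QE.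
suff -> : R = 0 by rewrite addr0.
have sR : (size R <= n)%N.
  by rewrite -ltnS -(size_XnsubC h n0) Pdiv.Ring.ltn_rmodpN0 // monic_neq0.
have := @powers_free k extension_curve n h x y n0 sep_h yxE x_transc a P (fun j =>
  R`_j) ha Pa.
move=> free; apply/polyP => i; rewrite coef0; have [ltin|] := ltnP i n; last first.
  by move=> le; rewrite nth_default // (leq_trans sR).
apply: (free _ (Ordinal ltin)); move: Q0; rewrite evE QE rmorphD rmorphM hornerD hornerM.
rewrite rmorphB /= map_polyXn map_polyC !hornerE yE subrr mulr0 add0r => R0.
rewrite -[RHS]R0 (@horner_coef_wide _ n) ?(leq_trans (size_poly _ _)) //.
by apply: eq_bigr => j _; rewrite coef_map evp_emb.
Qed.

End Existence.

(** A root y of any irreducible factor of Y^n - h is adjoined to k(X); [extension_model] shows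
    afterwards that y satisfies no relation of smaller degree. *)
Lemma superelliptic_exists (k : closedFieldType) n (h : {poly k}) :
  (0 < n)%N -> separable_poly h -> (1 < size h)%N ->
  exists C : curve k, is_curve n h C.
Proof.
move=> n0 sep_h sh; pose D : {poly {fraction {poly k}}} := 'X^n - (FracField.tofrac h)%:P.
have [|q irr qD] := @irreducible_factor _ D.
  by rewrite size_XnsubC // ltnS.
have [L _ [y qy gen]] := irredp_FAdjoin irr.
have yE : y ^+ n = in_alg L (FracField.tofrac h).
  have /eqP : root (map_poly (in_alg L) D) y.
    by case/dvdpP: qD => r ->; rewrite rmorphM rootM qy orbT.
  rewrite rmorphB /= map_polyXn map_polyC !hornerE => /eqP.
  by rewrite subr_eq0 => /eqP.
exists (extension_curve L); exists (in_alg L (FracField.tofrac 'X)), y.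
exact: (extension_model n0 sep_h sh yE gen).
Qed.

Theorem theorem3p2 (k : closedFieldType) (char0 : [pchar k] =i pred0) :
  [/\ (forall (n : nat) (C : curve k) (g : nat) (x y : C) (h : {poly k}),
         (2 <= n)%N -> (2 <= g)%N -> has_genus C g ->
         cyclic_cover n x -> affine_model n h x y -> separable_poly h ->
         (n <= 2 * g + 2)%N /\ (~ hyperelliptic C -> (n <= g + 2)%N)),
      (forall g : nat, (2 <= g)%N ->
         (exists C : curve k, is_curve (2 * g + 2) ('X^2 - 1) C) /\
         (forall C : curve k, is_curve (2 * g + 2) ('X^2 - 1) C ->
            has_genus C g)) &
      (forall n : nat, (3 %| n)%N -> (6 <= n)%N ->
         (exists C : curve k, is_curve n ('X^3 - 'X) C) /\
         (forall C : curve k, is_curve n ('X^3 - 'X) C ->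
            ~ hyperelliptic C /\
            exists2 g' : nat, has_genus C g' & n = (g' + 2)%N))].
Proof.
have genusP n (C : curve k) (x y : C) (h : {poly k}) : (0 < n)%N ->
  affine_model n h x y ->
    separable_poly h -> (1 < size h)%N -> has_genus C (model_genus n (size h).-1).
  move=> n0 model sep_h sh.
  have [a ha] : exists a, root h a by apply/closed_rootP; rewrite neq_ltn sh orbT.
  have [P Pa] := point_above a (model_transc n0 model) (model_spans n0 model).
  exact: (model_has_genus char0 n0 model sep_h ha Pa).
have nat0 m : (0 < m)%N -> m%:R != 0 :> k by move/pcharf0P: char0 => -> ; rewrite lt0n.
split=> [n C g x y h n2 g2 gC _ model sep_h|g g2|n n3 n6].
- have n0 : (0 < n)%N by exact: ltnW.
  have sh := model_nonconstant n0 model n2 (separable_poly_neq0 sep_h).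
  have := has_genus_unique gC (genusP _ _ _ _ _ n0 model sep_h sh).
  (* The size is the degree plus one. Degree 1 has genus 0, excluded by g >= 2; degree 2 is
     hyperelliptic; from degree 3 on, n <= g + 2 implies both bounds. *)
  case hm : (size h) sh => [|[|[|[|[|m]]]]] // _ gE.
  + by move: g2; rewrite gE model_genus1.
  + split; first by rewrite gE model_genus2.
    by move=> nhyp; case: nhyp; exact: (hyperelliptic_of_quadratic n0 model sep_h
      hm g2 gC).
  + suff le : (n <= g + 2)%N by split=> //; lia.
    by rewrite gE model_genus3.
  + suff le : (n <= g + 2)%N by split=> //; lia.
    by rewrite gE model_genus_ge4.
- have n0 : (0 < 2 * g + 2)%N by rewrite addn2.
  have sep_h : separable_poly ('X^2 - 1 : {poly k}) by apply: separable_Xn_sub_1;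
    exact: nat0.
  have sh : size ('X^2 - 1 : {poly k}) = 3 by rewrite size_XnsubC.
  split; first by apply: superelliptic_exists => //; rewrite sh.
  move=> C [x [y model]]; have := genusP _ _ _ _ _ n0 model sep_h.
  by rewrite sh model_genus2_even; apply.
have n0 : (0 < n)%N by exact: leq_trans n6.
have hE : 'X^3 - 'X = ('X^2 - 1) * ('X - 0%:P) :> {poly k}.
  by rewrite subr0 mulrBl mul1r -exprSr.
have sep_h : separable_poly ('X^3 - 'X : {poly k}).
  rewrite hE separable_root; apply/andP; split; first by apply: separable_Xn_sub_1;
    exact: nat0.
  by rewrite /root !hornerE expr0n /= sub0r oppr_eq0 oner_eq0.
have sh : size ('X^3 - 'X : {poly k}) = 4.
  by rewrite size_polyDl size_polyXn // size_polyN size_polyX.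
split; first by apply: superelliptic_exists => //; rewrite sh.
move=> C [x [y model]]; have := genusP _ _ _ _ _ n0 model sep_h;
  rewrite sh => /(_ isT) gC.
have nE := model_genus3_div n0 n3.
split; last by exists (model_genus n 3).
move=> [_ [t t_transc [b b_basis]]].
(* A function of degree 2 would bound the genus by 2, whereas it is n - 2 >= 4. *)
have := genus_le2 char0 n0 model sep_h sh b_basis t_transc.
by move: n6; rewrite {1}nE; move: (model_genus n 3); clear; lia.
Qed.
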